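(* Let $(A,\alpha,\mathbb{Z}^n_+)$ be a unital C*-dynamical system. Let $(B,\beta,\mathbb{Z}^n)$ be the product dilation, with embedding $\iota:A\to B$, and let $(\tilde C,\tilde\gamma,\mathbb{Z}^n)$ be the Davidson–Fuller–Kakariadis automorphic dilation defined in the context, with embedding $\eta:A\to\tilde C$. Let $I\triangleleft B$ be the unique maximal $\beta$-invariant $A$-boundary ideal. Then there is a $\mathbb{Z}^n$-equivariant $\ast$-isomorphism $B/I\cong\tilde C$ that fixes $A$ (i.e. sends $\iota(a)+I$ to $\eta(a)$ for all $a\in A$).
   Context: ''Ideal'' ($\triangleleft$) means closed two-sided ideal; for $K\triangleleft A$, $K^\perp=\{a\in A\mid ab=0\text{ for all }b\in K\}$. $\mathbb{Z}^n$ carries the coordinatewise lattice order with positive cone $\mathbb{Z}^n_+$ and standard generators $\mathbf{1},\dots,\mathbf{n}$. A C*-dynamical system $(A,\alpha,\mathbb{Z}^n_+)$ is a C*-algebra $A$ with a semigroup homomorphism $x\mapsto\alpha_x$, $\alpha_0=\mathrm{id}$, into $\ast$-endomorphisms of $A$; it is unital if $A$ and all $\alpha_x$ are unital; $\alpha_{\mathbf{i}}$ denotes the action of the generator $\mathbf{i}$. Product dilation: $\iota:A\to\prod_{\mathbb{Z}^n}A$ (bounded tuples) is $\iota(a)_g=\alpha_g(a)$ for $g\in\mathbb{Z}^n_+$ and $0$ otherwise; $\mathbb{Z}^n$ acts by $[\beta_g(x)]_h=x_{h+g}$; $B=C^\ast(\bigcup_{g}\beta_g\iota(A))$ with the restricted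 action. An $A$-boundary ideal of $B$ is an ideal $I\triangleleft B$ with $\iota(A)\cap I=\{0\}$; a unique maximal $\beta$-invariant one exists. It is explicitly $I=\overline{\bigcup_FI_F}$ over finite $F\subseteq\mathbb{Z}^n$, where $I_F=\{b\in B\mid b_g\in J_{F-g}\ \forall g\in\mathbb{Z}^n\}$, $J_F=K_F^\perp$, $K_F=\bigcap_{g\in F,\,g\not\le0}\ker\alpha_{g\vee0}$ (empty intersection $=A$). $B/I$ carries the induced action $\tilde\beta_g(b+I)=\beta_g(b)+I$. Construction of $(\tilde C,\tilde\gamma,\mathbb{Z}^n)$: for $x\in\mathbb{Z}^n_+$ let $\mathrm{supp}(x)=\{\mathbf{k}\mid x_k>0\}$; write $x\perp y$ if $x\wedge y=0$, i.e. $\mathrm{supp}(x)\cap\mathrm{supp}(y)=\emptyset$, and $x^\perp=\{y\in\mathbb{Z}^n_+\mid y\perp x\}$. Define ideals $Q^0_x=\left(\bigcap_{\mathbf{i}\in\mathrm{supp}(x)}\ker\alpha_{\mathbf{i}}\right)^\perp$ (empty intersection $=A$) and $Q_x=\bigcap_{y\in x^\perp}\alpha_y^{-1}(Q^0_x)$, so $Q_0=\{0\}$. Let $C=\bigoplus_{x\in\mathbb{Z}^n_+}A/Q_x$ be the C*-algebraic ($c_0$) direct sum, written $C=\overline{\sum_{x}\frac{A}{Q_x}\otimes e_x}$, and let $q_x:A\to A/Q_x$ be the quotient maps. An injective action $\gamma$ of $\mathbb{Z}^n_+$ on $C$ is determined by $$\gamma_{\mathbf{i}}(q_x(a)\otimes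 e_x)=\begin{cases}q_x(\alpha_{\mathbf{i}}(a))\otimes e_x+q_{x+\mathbf{i}}(a)\otimes e_{x+\mathbf{i}}&\mathbf{i}\perp x,\\ q_{x+\mathbf{i}}(a)\otimes e_{x+\mathbf{i}}&\mathbf{i}\in\mathrm{supp}(x).\end{cases}$$ $(\tilde C,\tilde\gamma,\mathbb{Z}^n)$ is the minimal automorphic extension of $(C,\gamma,\mathbb{Z}^n_+)$: the (unique up to equivariant isomorphism) C*-dynamical system with $C\subseteq\tilde C$, $\tilde\gamma_x|_C=\gamma_x$ for $x\in\mathbb{Z}^n_+$, and $\tilde C=\overline{\bigcup_{x\in\mathbb{Z}^n_+}\tilde\gamma_{-x}(C)}$. The embedding $\eta:A\to C\subseteq\tilde C$ is $\eta(a)=q_0(a)\otimes e_0$. *)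

(* Defs.v *)
From HB Require Import structures.
From mathcomp Require Import all_boot all_order all_algebra complex.
From mathcomp Require Import all_classical all_reals topology normedtype sequences.
From mathcomp Require Import ring.

Set Implicit Arguments.
Unset Strict Implicit.
Unset Printing Implicit Defensive.

Import Order.TTheory GRing.Theory Num.Theory.
Import numFieldNormedType.Exports.

Local Open Scope classical_set_scope.
Local Open Scope ring_scope.

(* Normed *-algebras over the complex numbers, without unit: C, B and B/I need
   not have one. Neither completeness nor the C*-identity is part of this
   class, so that quotients and c_0-sums get an instance from their algebraic
   definition alone; that they are C*-algebras is a theorem which the
   definitions below do not use. Norms take their values in R[i]. *)
HB.mixin Record isStarAlg (R : realType) A & NormedModule R[i] A := {
  smul : A -> A -> A;
  star : A -> A;
  smulA : associative smul;
  smulDl : left_distributive smul +%R;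
  smulDr : right_distributive smul +%R;
  smulZl : forall (c : R[i]) (a b : A), smul (c *: a) b = c *: smul a b;
  smulZr : forall (c : R[i]) (a b : A), smul a (c *: b) = c *: smul a b;
  norm_smul : forall a b : A, `|smul a b| <= `|a| * `|b|;
  starK : involutive star;
  starD : {morph star : a b / a + b};
  starZ : forall (c : R[i]) (a : A), star (c *: a) = (c^*)%R *: star a;
  starM : forall a b : A, star (smul a b) = smul (star b) (star a);
  norm_star : forall a : A, `|star a| = `|a|
}.

#[short(type="starAlgType")]
HB.structure Definition StarAlg (R : realType) :=
  {A of isStarAlg R A & NormedModule R[i] A}.

Arguments star {R s} _ : rename.
Arguments smul {R s} _ _ : rename.
Notation "a ** b" := (smul a b) (at level 40, left associativity) : ring_scope.

HB.mixin Record isCstar (R : realType) A & StarAlg R A := {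
  cstarE : forall a : A, `|star a ** a| = `|a| ^+ 2
}.

#[short(type="cstarAlgType")]
HB.structure Definition CstarAlg (R : realType) :=
  {A of isCstar R A & StarAlg R A & Complete A}.

(* *-homomorphisms carry no continuity clause: between C*-algebras it is
   automatic (see norm_star_hom for unital endomorphisms). *)
Definition star_hom (R : realType) (E F : starAlgType R) (f : E -> F) : Prop :=
  [/\ linear f,
      forall a b, f (a ** b) = f a ** f b &
      forall a, f (star a) = star (f a)].

Section StarAlgTheory.
Variables (R : realType) (E : starAlgType R).
Implicit Types a b x y : E.

Lemma smul0l a : 0 ** a = 0.
Proof. by apply: (@addrI _ (0 ** a)); rewrite -smulDl !addr0. Qed.

Lemma smul0r a : a ** 0 = 0.
Proof. by apply: (@addrI _ (a ** 0)); rewrite -smulDr !addr0. Qed.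

Lemma smulNl a b : (- a) ** b = - (a ** b).
Proof. by rewrite -scaleN1r smulZl scaleN1r. Qed.

Lemma smulNr a b : a ** (- b) = - (a ** b).
Proof. by rewrite -scaleN1r smulZr scaleN1r. Qed.

Lemma smulBl a b c : (a - b) ** c = a ** c - b ** c.
Proof. by rewrite smulDl smulNl. Qed.

Lemma smulBr a b c : c ** (a - b) = c ** a - c ** b.
Proof. by rewrite smulDr smulNr. Qed.

Lemma star0 : star (0 : E) = 0.
Proof. by rewrite -[X in star X](scale0r (0 : E)) starZ conjC0 scale0r. Qed.

Lemma starN a : star (- a) = - star a.
Proof. by rewrite -scaleN1r starZ rmorphN1 scaleN1r. Qed.

Lemma starB a b : star (a - b) = star a - star b.
Proof. by rewrite starD starN. Qed.

End StarAlgTheory.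

Lemma ge0_ReE (R : realType) (d : R[i]) : 0 <= d -> d = (complex.Re d)%:C%C.
Proof. by move=> d0; rewrite RRe_real// ger0_real. Qed.

Lemma lip_continuous (K : numFieldType) (V W : normedModType K) (f : V -> W)
    (k : K) : 0 <= k -> (forall x y, `|f x - f y| <= k * `|x - y|) ->
  continuous f.
Proof.
move=> k0 fk x; apply/cvgrPdist_lt => e e0.
have k1 : 0 < k + 1 by rewrite ltr_wpDl.
near=> y; rewrite (le_lt_trans (fk x y))//.
have yx : `|x - y| < e / (k + 1).
  by near: y; apply: cvgr_dist_lt => //; rewrite divr_gt0.
rewrite (@le_lt_trans _ _ ((k + 1) * `|x - y|))//.
  by rewrite ler_wpM2r// lerDl.
by rewrite mulrC -ltr_pdivlMr.
Unshelve. all: by end_near. Qed.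

Section continuity.
Variables (R : realType) (E : starAlgType R).

Lemma smull_continuous (a : E) : continuous (smul a).
Proof.
by apply: (@lip_continuous _ _ _ _ `|a|) => // x y; rewrite -smulBr norm_smul.
Qed.

Lemma smulr_continuous (a : E) : continuous (fun x => x ** a).
Proof.
apply: (@lip_continuous _ _ _ _ `|a|) => // x y.
by rewrite -smulBl mulrC norm_smul.
Qed.

Lemma star_continuous : continuous (@star R E).
Proof.
by apply: (@lip_continuous _ _ _ _ 1) => // x y; rewrite -starB norm_star mul1r.
Qed.

Lemma closed_preimage_eq0 (V W : normedModType R[i]) (f : V -> W) :
  continuous f -> closed [set x | f x = 0].
Proof.
move=> fc; have := @closed_comp _ _ f [set 0 : W].
apply; first by move=> x _; exact: fc.
exact: (@accessible_closed_set1 W (hausdorff_accessible (@norm_hausdorff _ _))).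
Qed.

End continuity.

Section star_hom.
Variables (R : realType) (E F : starAlgType R) (f : E -> F).
Hypothesis hf : star_hom f.

Lemma star_homZD c a b : f (c *: a + b) = c *: f a + f b.
Proof. by case: hf => + _ _; apply. Qed.
Lemma star_homM a b : f (a ** b) = f a ** f b.
Proof. by case: hf. Qed.
Lemma star_homS a : f (star a) = star (f a).
Proof. by case: hf. Qed.
Lemma star_hom0 : f 0 = 0.
Proof. by have := star_homZD (-1) 0 0; rewrite !scaleN1r !addNr. Qed.
Lemma star_homD a b : f (a + b) = f a + f b.
Proof. by have := star_homZD 1 a b; rewrite !scale1r. Qed.
Lemma star_homZ c a : f (c *: a) = c *: f a.
Proof. by have := star_homZD c a 0; rewrite star_hom0 !addr0. Qed.
Lemma star_homN a : f (- a) = - f a.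
Proof. by rewrite -scaleN1r star_homZ scaleN1r. Qed.
Lemma star_homB a b : f (a - b) = f a - f b.
Proof. by rewrite star_homD star_homN. Qed.

End star_hom.

(* Unital *-endomorphisms of a unital C*-algebra are contractive. This is what
   makes the tuple (alpha_g(a))_g bounded and the ideals dfk_Q closed. Square
   roots of e - h^2 come from the contraction z |-> (h^2 + z^2) / 2; with
   f(h)^2 + f(y)^2 = e, the element f(h) + i f(y) is unitary. *)
Section contractive.
Variables (R : realType) (A : cstarAlgType R) (e : A).
Hypothesis (e1l : forall a, e ** a = a) (e1r : forall a, a ** e = a).

Lemma star_unit : star e = e.
Proof. by rewrite -[in RHS](starK e) -[in RHS](e1r (star e)) starM starK. Qed.

Lemma norm_unit_le1 : `|e| <= 1.
Proof.
have := cstarE e; rewrite star_unit e1l expr2 => ee.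
have [->|e0] := eqVneq e 0; first by rewrite normr0 ler01.
suff -> : `|e| = 1 by [].
by apply: (mulfI (_ : `|e| != 0)); rewrite ?normr_eq0// mulr1 -ee.
Qed.

Section square_root.
Variable h : A.
Hypotheses (h_sa : star h = h) (h_lt1 : `|h| < 1).
Let k := h ** h.

Let sqrt_iter := fix F (m : nat) : A :=
  if m is m'.+1 then 2^-1 *: (k + F m' ** F m') else 0.

Let c := `|h|.

Let k_le : `|k| <= c.
Proof.
by rewrite (le_trans (norm_smul _ _))// ler_piMl// ltW.
Qed.

Let norm_half (x : A) : `|2^-1 *: x| = 2^-1 * `|x|.
Proof. by rewrite normrZ ger0_norm// invr_ge0 ler0n. Qed.

Let half_le (x y z : R[i]) : x <= z -> y <= z -> 2^-1 * (x + y) <= z.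
Proof.
by move=> xz yz; rewrite ler_pdivrMl ?ltr0n// mulr_natl mulr2n lerD.
Qed.

Let iter_le m : `|sqrt_iter m| <= c.
Proof.
elim: m => [|m ih] /=; first by rewrite normr0 normr_ge0.
rewrite norm_half (le_trans (ler_wpM2l _ (ler_normD _ _)))//.
  by rewrite invr_ge0 ler0n.
apply: half_le => //; rewrite (le_trans (norm_smul _ _))//.
by rewrite (le_trans (ler_pM _ _ ih ih))// ler_piMl ?normr_ge0// ltW.
Qed.

Let iterS m : sqrt_iter m.+1 = 2^-1 *: (k + sqrt_iter m ** sqrt_iter m).
Proof. by []. Qed.

Let iter_step m : `|sqrt_iter m.+1 - sqrt_iter m| <= c ^+ m.+1.
Proof.
elim: m => [|m ih].
  rewrite iterS /= smul0l addr0 subr0 norm_half expr1 ler_pdivrMl ?ltr0n//.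
  by rewrite (le_trans k_le)// mulr_natl mulr2n lerDl normr_ge0.
rewrite !(iterS m.+1) {2}iterS -scalerBr norm_half.
set z := sqrt_iter m.+1 in ih *; set w := sqrt_iter m in ih *.
have -> : k + z ** z - (k + w ** w) = z ** (z - w) + (z - w) ** w.
  by rewrite smulBr smulBl addrA subrK opprD addrACA subrr add0r.
rewrite (le_trans (ler_wpM2l _ (ler_normD _ _)))//.
  by rewrite invr_ge0 ler0n.
apply: half_le; rewrite (le_trans (norm_smul _ _))// exprS.
  by rewrite ler_pM// /z.
by rewrite mulrC ler_pM// /w.
Qed.

Let iter_dist m p :
  `|sqrt_iter (m + p)%N - sqrt_iter m| * (1 - c) <= c ^+ m.+1 * (1 - c ^+ p).
Proof.
have c1 : 0 <= 1 - c by rewrite subr_ge0 ltW.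
elim: p => [|p ih]; first by rewrite addn0 subrr normr0 mul0r expr0 subrr mulr0.
have -> : c ^+ m.+1 * (1 - c ^+ p.+1) =
    c ^+ (m + p).+1 * (1 - c) + c ^+ m.+1 * (1 - c ^+ p).
  by rewrite -addSn exprD [c ^+ p.+1]exprS; ring.
rewrite addnS -(subrK (sqrt_iter (m + p)%N) (sqrt_iter (m + p).+1)) -addrA.
rewrite (le_trans (ler_wpM2r c1 (ler_normD _ _)))// mulrDl lerD//.
by rewrite ler_wpM2r.
Qed.

Let c_expr_small (d : R[i]) : 0 < d -> exists N, c ^+ N < d.
Proof.
move=> d0; have cE : c = (complex.Re c)%:C%C := ge0_ReE (normr_ge0 h).
have dE : d = (complex.Re d)%:C%C by exact: ge0_ReE (ltW d0).
have rc1 : `|complex.Re c| < 1.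
  have c0 : 0 <= c := normr_ge0 _.
  rewrite ger0_norm; first by rewrite -ltcR -cE.
  by rewrite -lecR -cE.
have d0' : 0 < complex.Re d by rewrite -ltcR -dE.
have /cvgrPdist_lt /(_ _ d0') [N _ /(_ N (leqnn N))] := cvg_expr rc1.
rewrite sub0r normrN /= => cN; exists N.
rewrite dE cE -rmorphXn ltcR; apply: le_lt_trans cN; exact: ler_norm.
Qed.

Let iter_cvg : cvgn sqrt_iter.
Proof.
apply: cauchy_cvg; apply: cauchy_exP => eps eps0.
have c1 : 0 < 1 - c by rewrite subr_gt0.
have [N cN] := c_expr_small (mulr_gt0 eps0 c1).
exists (sqrt_iter N); exists N => // m /= Nm.
rewrite -ball_normE /= distrC -(subnKC Nm) -(ltr_pM2r c1).
apply: (le_lt_trans (iter_dist _ _)); apply: le_lt_trans cN.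
have c0 : 0 <= c := normr_ge0 _.
apply: (@le_trans _ _ (c ^+ N.+1)).
  by rewrite ler_piMr ?exprn_ge0// gerBl exprn_ge0.
by rewrite exprS ler_piMl ?exprn_ge0// ltW.
Qed.

Lemma exists_sqrt : exists y, [/\ star y = y, y ** h = h ** y &
  h ** h + y ** y = e].
Proof.
have [a a_lim] := (cvg_ex _).1 iter_cvg.
have a_in (f : A -> A) : continuous f -> (forall m, f (sqrt_iter m) = 0) ->
    f a = 0.
  move=> fc f0; apply: (closed_cvg [set x | f x = 0] _ _ _ a_lim).
    exact: closed_preimage_eq0.
  exact: nearW.
have a_sa : star a = a.
  apply/subr0_eq; apply: (a_in (fun x => star x - x)).
    move=> x; apply: cvgB; [exact: star_continuous|exact: cvg_id].
  move=> m; apply/eqP; rewrite subr_eq0; apply/eqP; elim: m => [|m /= ih]; first by rewrite /= star0.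
  by rewrite starZ starD !starM ih h_sa fmorphV rmorph_nat.
have a_h : a ** h = h ** a.
  apply/subr0_eq; apply: (a_in (fun x => x ** h - h ** x)).
    move=> x; apply: cvgB; [exact: smulr_continuous|exact: smull_continuous].
  move=> m; apply/eqP; rewrite subr_eq0; apply/eqP; elim: m => [|m /= ih].
    by rewrite /= smul0l smul0r.
  rewrite smulZl smulZr smulDl smulDr; congr (_ *: (_ + _)).
    by rewrite smulA.
  by rewrite -smulA ih smulA ih smulA.
have a_fix : a = 2^-1 *: (k + a ** a).
  have l1 : sqrt_iter (S m) @[m --> \oo] --> a.
    by have := a_lim; rewrite -cvg_shiftS.
  have l2 : sqrt_iter (S m) @[m --> \oo] --> 2^-1 *: (k + a ** a).
    rewrite /=; apply: cvgZl_tmp.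
    apply: cvgD.
      exact: cvg_cst.
    apply/cvgrPdist_lt => d d0.
    have M0 : 0 < `|a| + c + 1 by rewrite ltr_wpDl ?addr_ge0 ?normr_ge0.
    near=> m; have zm : `|a - sqrt_iter m| < d / (`|a| + c + 1).
      by near: m; move/cvgrPdist_lt : a_lim; apply; rewrite divr_gt0.
    have -> : a ** a - sqrt_iter m ** sqrt_iter m =
        a ** (a - sqrt_iter m) + (a - sqrt_iter m) ** sqrt_iter m.
      by rewrite smulBr smulBl addrA subrK.
    rewrite (le_lt_trans (ler_normD _ _))//.
    apply: (@le_lt_trans _ _ (`|a - sqrt_iter m| * (`|a| + c + 1))).
      rewrite mulrDr mulr1 -[leLHS]addr0 lerD// mulrDr lerD//.
        by rewrite mulrC norm_smul.
      by rewrite (le_trans (norm_smul _ _))// ler_wpM2l.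
    by rewrite -ltr_pdivlMr.
  exact: (cvg_unique _ l1 l2).
exists (e - a); split.
- by rewrite starB star_unit a_sa.
- by rewrite smulBl smulBr e1l e1r a_h.
- have aa : a + a = h ** h + a ** a.
    by rewrite -mulr2n -scaler_nat {1}a_fix scalerA mulfV ?scale1r ?pnatr_eq0.
  rewrite smulBl !smulBr !e1l e1r -(addrK (a ** a) (h ** h)) -aa.
  rewrite [e - a - _](_ : _ = e - (a + a - a ** a)).
    by rewrite addrC subrK.
  by rewrite -addrA -opprD -addrA.
Unshelve. all: by end_near. Qed.
End square_root.

Lemma norm_star_hom_sa_le1 (f : A -> A) (h : A) : star_hom f -> f e = e ->
  star h = h -> `|h| < 1 -> `|f h| <= 1.
Proof.
move=> hf fe h_sa h1; have [y [y_sa yh hy]] := exists_sqrt h_sa h1.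
set h' := f h; set y' := f y.
have h'_sa : star h' = h' by rewrite /h' -(star_homS hf) h_sa.
have y'_sa : star y' = y' by rewrite /y' -(star_homS hf) y_sa.
have y'h' : y' ** h' = h' ** y' by rewrite /y' /h' -!(star_homM hf) yh.
have hy' : h' ** h' + y' ** y' = e.
  by rewrite /y' /h' -!(star_homM hf) -(star_homD hf) hy.
pose u := h' + 'i *: y'.
have star_u : star u = h' - 'i *: y'.
  by rewrite starD starZ conjCi h'_sa y'_sa scaleNr.
have u_le1 : `|u| <= 1.
  have : star u ** u = e.
    rewrite star_u smulBl !smulDr !smulZl !smulZr y'h' scalerA -expr2 sqrCi.
    by rewrite scaleN1r opprD opprK addrA addrK.
  move=> uu; have := cstarE u; rewrite uu => eu.
  by rewrite -(@ler_pXn2r _ 2)// ?nnegrE// expr1n -eu norm_unit_le1.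
have : `|h' + h'| <= 1 + 1.
  have -> : h' + h' = u + star u by rewrite star_u /u addrACA subrr addr0.
  by rewrite (le_trans (ler_normD _ _))// lerD// norm_star.
rewrite -mulr2n normrMn -mulr_natr -[1 + 1]mul1r.
by rewrite ler_pM2r// ltr0n.
Qed.

Lemma norm_star_hom (f : A -> A) (x : A) : star_hom f -> f e = e ->
  `|f x| <= `|x|.
Proof.
move=> hf fe; rewrite real_leNgt ?normr_real//; apply/negP => xfx.
pose t := (`|x| + `|f x|) / 2.
have xt : `|x| < t by rewrite /t midf_lt.
have tfx : t < `|f x| by rewrite /t midf_lt.
have t0 : 0 < t by rewrite (le_lt_trans _ xt).
pose b := t^-1 *: x.
have nb : `|b| < 1.
  rewrite /b normrZ ger0_norm ?invr_ge0 ?ltW// mulrC ltr_pdivrMr// mul1r.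
  exact: xt.
have nfb : 1 < `|f b|.
  rewrite /b (star_homZ hf) normrZ ger0_norm ?invr_ge0 ?ltW// mulrC.
  by rewrite ltr_pdivlMr// mul1r.
have := @norm_star_hom_sa_le1 f (star b ** b) hf fe.
rewrite starM starK => /(_ erefl); rewrite cstarE.
rewrite exprn_ilt1// => /(_ isT).
rewrite (star_homM hf) (star_homS hf) cstarE real_leNgt ?rpredX ?normr_real//.
by rewrite exprn_egt1.
Qed.

End contractive.

(* The l^oo-product of a family of normed *-algebras, with the supremum norm. *)
Section BoundedProduct.
Variables (R : realType) (I : Type) (E : I -> starAlgType R).

Record bprod := BProd {
  bfun :> forall i, E i;
  bfun_bounded : exists M : R[i], forall i, `|bfun i| <= M
}.

HB.instance Definition _ := gen_eqMixin bprod.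
HB.instance Definition _ := gen_choiceMixin bprod.

Implicit Types f g : bprod.

Lemma bprodP f g : (forall i, f i = g i) -> f = g.
Proof.
case: f g => [f hf] [g hg] /= fg; have fgE : f = g by exact: functional_extensionality_dep.
by case: _ / fgE hg => hg; congr BProd; exact: Prop_irrelevance.
Qed.

Fact bprod0_subproof : exists M : R[i], forall i, `|0 : E i| <= M.
Proof. by exists 0 => i; rewrite normr0. Qed.
Definition bprod0 : bprod := BProd bprod0_subproof.

Fact bprodD_subproof f g : exists M : R[i], forall i, `|f i + g i| <= M.
Proof.
case: f g => [f [M fM]] [g [N gN]]; exists (M + N) => i.
by rewrite (le_trans (ler_normD _ _))// lerD.
Qed.
Definition bprodD f g : bprod := BProd (bprodD_subproof f g).

Fact bprodN_subproof f : exists M : R[i], forall i, `|- f i| <= M.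
Proof. by case: f => [f [M fM]]; exists M => i; rewrite normrN. Qed.
Definition bprodN f : bprod := BProd (bprodN_subproof f).

Fact bprodZ_subproof c f : exists M : R[i], forall i, `|c *: f i| <= M.
Proof.
by case: f => [f [M fM]]; exists (`|c| * M) => i; rewrite normrZ ler_wpM2l ?fM.
Qed.
Definition bprodZ c f : bprod := BProd (bprodZ_subproof c f).

Fact bprodM_subproof f g : exists M : R[i], forall i, `|f i ** g i| <= M.
Proof.
case: f g => [f [M fM]] [g [N gN]]; exists (M * N) => i.
by rewrite (le_trans (norm_smul _ _))// ler_pM ?fM ?gN.
Qed.
Definition bprodM f g : bprod := BProd (bprodM_subproof f g).

Fact bprodS_subproof f : exists M : R[i], forall i, `|star (f i)| <= M.
Proof. by case: f => [f [M fM]]; exists M => i; rewrite norm_star fM. Qed.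
Definition bprodS f : bprod := BProd (bprodS_subproof f).

Fact bprodDA : associative bprodD.
Proof. by move=> f g h; apply: bprodP => i /=; rewrite addrA. Qed.
Fact bprodDC : commutative bprodD.
Proof. by move=> f g; apply: bprodP => i /=; rewrite addrC. Qed.
Fact bprod0D : left_id bprod0 bprodD.
Proof. by move=> f; apply: bprodP => i /=; rewrite add0r. Qed.
Fact bprodND : left_inverse bprod0 bprodN bprodD.
Proof. by move=> f; apply: bprodP => i /=; rewrite addNr. Qed.

HB.instance Definition _ :=
  GRing.isZmodule.Build bprod bprodDA bprodDC bprod0D bprodND.

Fact bprodZA a b f : bprodZ a (bprodZ b f) = bprodZ (a * b) f.
Proof. by apply: bprodP => i /=; rewrite scalerA. Qed.
Fact bprodZ1 : left_id 1 bprodZ.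
Proof. by move=> f; apply: bprodP => i /=; rewrite scale1r. Qed.
Fact bprodZDr : right_distributive bprodZ +%R.
Proof. by move=> a f g; apply: bprodP => i /=; rewrite scalerDr. Qed.
Fact bprodZDl f : {morph bprodZ^~ f : a b / a + b}.
Proof. by move=> a b; apply: bprodP => i /=; rewrite scalerDl. Qed.

HB.instance Definition _ := GRing.Zmodule_isLmodule.Build R[i] bprod
  bprodZA bprodZ1 bprodZDr bprodZDl.

Definition bprod_norm f : R[i] :=
  (sup [set complex.Re `|f i| | i in [set: I]])%:C%C.

Let bprod_has_ub f : has_ubound [set complex.Re `|f i| | i in [set: I]].
Proof.
case: f => [f [M fM]]; exists (complex.Re M) => _ [i _ <-] /=.
by move: (fM i); rewrite lecE => /andP[].
Qed.

Lemma bprod_norm_ub f i : `|f i| <= bprod_norm f.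
Proof.
rewrite (ge0_ReE (normr_ge0 (f i))) lecR.
by apply: ub_le_sup => //; exists i.
Qed.

Lemma bprod_norm_le f (M : R[i]) :
  0 <= M -> (forall i, `|f i| <= M) -> bprod_norm f <= M.
Proof.
move=> M0 fM; rewrite (ge0_ReE M0) lecR.
have [[i _]|/set0P/negP/negPn/eqP I0] := pselect ([set: I] !=set0).
  apply: ge_sup; first by exists (complex.Re `|f i|), i.
  by move=> _ [j _ <-]; move: (fM j); rewrite lecE => /andP[].
by rewrite I0 image_set0 sup0; move: M0; rewrite lecE => /andP[].
Qed.

Lemma bprod_norm_ge0 f : 0 <= bprod_norm f.
Proof.
have [[i _]|/set0P/negP/negPn/eqP I0] := pselect ([set: I] !=set0).
  exact: le_trans (normr_ge0 (f i)) (bprod_norm_ub f i).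
by rewrite /bprod_norm I0 image_set0 sup0.
Qed.

Fact bprod_normD f g : bprod_norm (f + g) <= bprod_norm f + bprod_norm g.
Proof.
apply: bprod_norm_le => [|i]; first by rewrite addr_ge0 ?bprod_norm_ge0.
by rewrite (le_trans (ler_normD _ _))// lerD ?bprod_norm_ub.
Qed.

Fact bprod_normZ c f : bprod_norm (c *: f) = `|c| * bprod_norm f.
Proof.
have le_nZ d g : bprod_norm (d *: g) <= `|d| * bprod_norm g.
  apply: bprod_norm_le => [|i]; first by rewrite mulr_ge0 ?bprod_norm_ge0.
  by rewrite /= normrZ ler_wpM2l ?bprod_norm_ub.
apply/eqP; rewrite eq_le le_nZ /=.
have [->|c0] := eqVneq c 0; first by rewrite normr0 mul0r bprod_norm_ge0.
rewrite -ler_pdivlMl ?normr_gt0// -normfV.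
by rewrite -[in leLHS](scale1r f) -(mulVf c0) -scalerA le_nZ.
Qed.

Fact bprod_norm0_eq0 f : bprod_norm f = 0 -> f = 0.
Proof.
move=> f0; apply: bprodP => i; apply/eqP.
by rewrite -normr_le0 -f0 bprod_norm_ub.
Qed.

HB.instance Definition _ := @Lmodule_isNormed.Build R[i] bprod bprod_norm
  bprod_normD bprod_normZ bprod_norm0_eq0.

Lemma bprod_norm_smul f g : `|bprodM f g| <= `|f| * `|g|.
Proof.
apply: bprod_norm_le => [|i]; first by rewrite mulr_ge0.
by rewrite (le_trans (norm_smul _ _))// ler_pM ?bprod_norm_ub.
Qed.

Lemma bprod_norm_star f : `|bprodS f| = `|f|.
Proof.
apply/eqP; rewrite eq_le; apply/andP; split; apply: bprod_norm_le => // i.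
  by rewrite norm_star bprod_norm_ub.
by rewrite -norm_star (bprod_norm_ub (bprodS f)).
Qed.

Fact bprodM_A : associative bprodM.
Proof. by move=> f g h; apply: bprodP => i /=; rewrite smulA. Qed.
Fact bprodM_Dl : left_distributive bprodM +%R.
Proof. by move=> f g h; apply: bprodP => i /=; rewrite smulDl. Qed.
Fact bprodM_Dr : right_distributive bprodM +%R.
Proof. by move=> f g h; apply: bprodP => i /=; rewrite smulDr. Qed.
Fact bprodM_Zl c f g : bprodM (c *: f) g = c *: bprodM f g.
Proof. by apply: bprodP => i /=; rewrite smulZl. Qed.
Fact bprodM_Zr c f g : bprodM f (c *: g) = c *: bprodM f g.
Proof. by apply: bprodP => i /=; rewrite smulZr. Qed.
Fact bprodS_K : involutive bprodS.
Proof. by move=> f; apply: bprodP => i /=; rewrite starK. Qed.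
Fact bprodS_D : {morph bprodS : f g / f + g}.
Proof. by move=> f g; apply: bprodP => i /=; rewrite starD. Qed.
Fact bprodS_Z c f : bprodS (c *: f) = (c^*)%R *: bprodS f.
Proof. by apply: bprodP => i /=; rewrite starZ. Qed.
Fact bprodS_M f g : bprodS (bprodM f g) = bprodM (bprodS g) (bprodS f).
Proof. by apply: bprodP => i /=; rewrite starM. Qed.

HB.instance Definition _ := isStarAlg.Build R bprod
  bprodM_A bprodM_Dl bprodM_Dr bprodM_Zl bprodM_Zr bprod_norm_smul
  bprodS_K bprodS_D bprodS_Z bprodS_M bprod_norm_star.

End BoundedProduct.

Definition is_substar (R : realType) (E : starAlgType R) (S : set E) : Prop :=
  [/\ closed S,
      S 0,
      forall (c : R[i]) x y, S x -> S y -> S (c *: x + y),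
      forall x y, S x -> S y -> S (x ** y) &
      forall x, S x -> S (star x)].

Record substar (R : realType) (E : starAlgType R) := SubStar {
  substar_set : set E;
  substarP : is_substar substar_set
}.

Section SubStarAlgebra.
Variables (R : realType) (E : starAlgType R) (S : substar E).

Definition substar_pred : {pred E} := fun x => `[< substar_set S x >].

Fact substar_submod : submod_closed substar_pred.
Proof.
case: (substarP S) => _ S0 SD _ _; split; first exact/asboolP.
by move=> c x y /asboolP Sx /asboolP Sy; apply/asboolP; exact: SD.
Qed.

HB.instance Definition _ :=
  GRing.isSubmodClosed.Build R[i] E substar_pred substar_submod.

Record substar_type := SubStarElt {
  subval :> E;
  subvalP : subval \in substar_pred
}.

HB.instance Definition _ := [isSub for subval].
HB.instance Definition _ := [Choice of substar_type by <:].
HB.instance Definition _ := [SubChoice_isSubLmodule of substar_type by <:].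

Implicit Types x y : substar_type.

Lemma subval_in x : substar_set S (subval x).
Proof. by apply/asboolP; exact: subvalP. Qed.

Definition subelt (a : E) (Sa : substar_set S a) : substar_type :=
  SubStarElt (asboolT Sa : a \in substar_pred).

Definition subM x y : substar_type :=
  subelt (let: And5 _ _ _ SM _ := substarP S in
          SM _ _ (subval_in x) (subval_in y)).

Definition subS x : substar_type :=
  subelt (let: And5 _ _ _ _ SS := substarP S in SS _ (subval_in x)).

Lemma subvalD x y : subval (x + y) = subval x + subval y.
Proof. exact: (raddfD (val : substar_type -> E)). Qed.

Lemma subvalZ (c : R[i]) x : subval (c *: x) = c *: subval x.
Proof. by rewrite -[LHS]/(val (c *: x)) linearZ. Qed.

Lemma subval0 : subval (0 : substar_type) = 0.
Proof. exact: (raddf0 (val : substar_type -> E)). Qed.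

Fact substar_normD x y :
  `|subval (x + y)| <= `|subval x| + `|subval y|.
Proof. by rewrite subvalD ler_normD. Qed.

Fact substar_normZ c x : `|subval (c *: x)| = `|c| * `|subval x|.
Proof. by rewrite subvalZ normrZ. Qed.

Fact substar_norm0_eq0 x : `|subval x| = 0 -> x = 0.
Proof. by move/normr0_eq0 => x0; apply/val_inj; rewrite /= x0. Qed.

HB.instance Definition _ := @Lmodule_isNormed.Build R[i] substar_type
  (fun x => `|subval x|) substar_normD substar_normZ substar_norm0_eq0.

Fact subM_A : associative subM.
Proof. by move=> x y z; apply/val_inj; rewrite /= smulA. Qed.
Fact subM_Dl : left_distributive subM +%R.
Proof. by move=> x y z; apply/val_inj; rewrite /= smulDl. Qed.
Fact subM_Dr : right_distributive subM +%R.
Proof. by move=> x y z; apply/val_inj; rewrite /= smulDr. Qed.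
Fact subM_Zl c x y : subM (c *: x) y = c *: subM x y.
Proof. by apply/val_inj; rewrite /= smulZl. Qed.
Fact subM_Zr c x y : subM x (c *: y) = c *: subM x y.
Proof. by apply/val_inj; rewrite /= smulZr. Qed.
Fact sub_norm_smul x y : `|subM x y| <= `|x| * `|y|.
Proof. exact: norm_smul. Qed.
Fact subS_K : involutive subS.
Proof. by move=> x; apply/val_inj; rewrite /= starK. Qed.
Fact subS_D : {morph subS : x y / x + y}.
Proof. by move=> x y; apply/val_inj; rewrite /= starD. Qed.
Fact subS_Z c x : subS (c *: x) = (c^*)%R *: subS x.
Proof. by apply/val_inj; rewrite /= starZ. Qed.
Fact subS_M x y : subS (subM x y) = subM (subS y) (subS x).
Proof. by apply/val_inj; rewrite /= starM. Qed.
Fact sub_norm_star x : `|subS x| = `|x|.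
Proof. exact: norm_star. Qed.

HB.instance Definition _ := isStarAlg.Build R substar_type
  subM_A subM_Dl subM_Dr subM_Zl subM_Zr sub_norm_smul
  subS_K subS_D subS_Z subS_M sub_norm_star.

End SubStarAlgebra.

(* Closed two-sided ideals. *)
Definition is_ideal (R : realType) (E : starAlgType R) (K : set E) : Prop :=
  [/\ closed K,
      K 0,
      forall (c : R[i]) x y, K x -> K y -> K (c *: x + y),
      forall a x, K x -> K (a ** x) &
      forall a x, K x -> K (x ** a)].

(* Closed two-sided ideals of C*-algebras are automatically selfadjoint, but
   the involution of the quotient needs this fact. It is therefore proved for
   each ideal by which we divide (dfk_Q_star, max_boundary_ideal_star), and
   is_ideal itself does not require it. *)
Record sideal (R : realType) (E : starAlgType R) := SIdeal {
  ideal_set : set E;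
  idealP : is_ideal ideal_set;
  ideal_star : forall x, ideal_set x -> ideal_set (star x)
}.

Section QuotientAlgebra.
Local Open Scope quotient_scope.
Variables (R : realType) (E : starAlgType R) (J : sideal E).
Local Notation K := (ideal_set J).

Definition ideal_pred : {pred E} := fun x => `[< K x >].

Fact ideal_submod : submod_closed ideal_pred.
Proof.
case: (idealP J) => _ K0 KD _ _; split; first exact/asboolP.
by move=> c x y /asboolP Kx /asboolP Ky; apply/asboolP; exact: KD.
Qed.

HB.instance Definition _ :=
  GRing.isSubmodClosed.Build R[i] E ideal_pred ideal_submod.

Definition quot_alg : Type := Quotient.quot ideal_pred.

HB.instance Definition _ := GRing.Zmodule.on quot_alg.

Definition quot_map (a : E) : quot_alg := \pi_(Quotient.quot ideal_pred) a.
Definition quot_repr (u : quot_alg) : E := repr (u : Quotient.quot ideal_pred).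

Lemma quot_reprK : cancel quot_repr quot_map.
Proof. by move=> u; rewrite /quot_map /quot_repr reprK. Qed.

Lemma quot_mapP (a b : E) : quot_map a = quot_map b <-> K (a - b).
Proof.
split=> [ab|Kab].
  apply/asboolP; rewrite -[`[< _ >]]/(a - b \in ideal_pred).
  by rewrite Quotient.idealrBE; apply/eqP; exact: ab.
apply/eqP; rewrite -[_ == _]/(a == b %[mod (Quotient.quot ideal_pred)]).
by rewrite -Quotient.idealrBE; apply/asboolP.
Qed.

Lemma quot_mapD (a b : E) : quot_map (a + b) = quot_map a + quot_map b.
Proof. exact: (raddfD (\pi_(Quotient.quot ideal_pred))). Qed.

Lemma quot_map0 : quot_map 0 = 0.
Proof. exact: (raddf0 (\pi_(Quotient.quot ideal_pred))). Qed.

Lemma quot_mapK (a : E) : K (quot_repr (quot_map a) - a).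
Proof. by apply/quot_mapP; rewrite quot_reprK. Qed.

Lemma quot_ind (P : quot_alg -> Prop) : (forall a, P (quot_map a)) ->
  forall u, P u.
Proof. by move=> Pa u; rewrite -(quot_reprK u). Qed.

Definition quotZ (c : R[i]) (u : quot_alg) := quot_map (c *: quot_repr u).
Definition quotM (u v : quot_alg) := quot_map (quot_repr u ** quot_repr v).
Definition quotS (u : quot_alg) := quot_map (star (quot_repr u)).

Lemma quotZE c a : quotZ c (quot_map a) = quot_map (c *: a).
Proof.
case: (idealP J) => _ K0 KD _ _; apply/quot_mapP.
by rewrite -scalerBr -[_ *: _]addr0; apply: KD => //; exact: quot_mapK.
Qed.

Lemma quotME a b : quotM (quot_map a) (quot_map b) = quot_map (a ** b).
Proof.
case: (idealP J) => _ K0 KD Kl Kr; apply/quot_mapP.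
set a' := quot_repr _; set b' := quot_repr _.
have -> : a' ** b' - a ** b = 1 *: ((a' - a) ** b') + a ** (b' - b).
  by rewrite scale1r smulBl smulBr addrA subrK.
by apply: KD; [apply: Kr|apply: Kl]; exact: quot_mapK.
Qed.

Lemma quotSE a : quotS (quot_map a) = quot_map (star a).
Proof.
by apply/quot_mapP; rewrite -starB; apply: ideal_star; exact: quot_mapK.
Qed.

Fact quotZA a b u : quotZ a (quotZ b u) = quotZ (a * b) u.
Proof. by elim/quot_ind: u => u; rewrite !quotZE scalerA. Qed.
Fact quotZ1 : left_id 1 quotZ.
Proof. by elim/quot_ind => u; rewrite quotZE scale1r. Qed.
Fact quotZDr : right_distributive quotZ +%R.
Proof.
move=> c; elim/quot_ind => u; elim/quot_ind => v.
by rewrite -quot_mapD !quotZE scalerDr quot_mapD.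
Qed.
Fact quotZDl u : {morph quotZ^~ u : a b / a + b}.
Proof.
by elim/quot_ind: u => u a b; rewrite !quotZE scalerDl quot_mapD.
Qed.

HB.instance Definition _ := GRing.Zmodule_isLmodule.Build R[i] quot_alg
  quotZA quotZ1 quotZDr quotZDl.

Lemma quot_mapZ c a : quot_map (c *: a) = c *: quot_map a.
Proof. by rewrite -quotZE. Qed.

Definition quot_norm (u : quot_alg) : R[i] :=
  (inf [set complex.Re `|a| | a in [set a | quot_map a = u]])%:C%C.

Let quot_has_lb u :
  has_lbound [set complex.Re `|a| | a in [set a | quot_map a = u]].
Proof.
exists 0 => _ [a _ <-].
by have := normr_ge0 a; rewrite lecE => /andP[].
Qed.

Let quot_nonempty u :
  [set complex.Re `|a| | a in [set a | quot_map a = u]] !=set0.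
Proof.
by exists (complex.Re `|quot_repr u|), (quot_repr u) => //=; exact: quot_reprK.
Qed.

Lemma quot_norm_le a : quot_norm (quot_map a) <= `|a|.
Proof.
by rewrite (ge0_ReE (normr_ge0 a)) lecR; apply: ge_inf => //; exists a.
Qed.

Lemma quot_norm_ge u (x c : R[i]) : x \is Num.real -> 0 <= c ->
  (forall a, quot_map a = u -> x <= c * `|a|) -> x <= c * quot_norm u.
Proof.
move=> xr c0 xa; have [c00|c_neq0] := eqVneq c 0.
  by move: (xa _ (quot_reprK u)); rewrite c00 !mul0r.
have c_gt0 : 0 < c by rewrite lt_neqAle eq_sym c_neq0.
rewrite -ler_pdivrMl//.
have xcr : c^-1 * x \is Num.real by rewrite realM// realV ger0_real.
rewrite -(RRe_real xcr) lecR; apply: lb_le_inf => // _ [a au <-].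
by rewrite -lecR (RRe_real xcr) -ge0_ReE// ler_pdivrMl// xa.
Qed.

Lemma quot_norm_ge0 u : 0 <= quot_norm u.
Proof.
have := @quot_norm_ge u 0 1 _ ler01; rewrite mul1r; apply.
  exact: real0.
by move=> a _; rewrite mul1r.
Qed.

Lemma quot_norm_real u : quot_norm u \is Num.real.
Proof. by rewrite ger0_real ?quot_norm_ge0. Qed.

Fact quot_normD u v : quot_norm (u + v) <= quot_norm u + quot_norm v.
Proof.
rewrite -lerBlDr -[leRHS]mul1r.
apply: quot_norm_ge => //; first by rewrite realB ?quot_norm_real.
move=> a <-; rewrite mul1r lerBlDr -lerBlDl -[leRHS]mul1r.
apply: quot_norm_ge => //; first by rewrite realB ?quot_norm_real ?normr_real.
move=> b <-; rewrite mul1r lerBlDl.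
by rewrite -quot_mapD (le_trans (quot_norm_le _))// ler_normD.
Qed.

Fact quot_normZ c u : quot_norm (c *: u) = `|c| * quot_norm u.
Proof.
have le_nZ d v : quot_norm (d *: v) <= `|d| * quot_norm v.
  apply: quot_norm_ge; rewrite ?quot_norm_real// => a <-.
  by rewrite -quot_mapZ -normrZ quot_norm_le.
apply/eqP; rewrite eq_le le_nZ /=.
have [->|c0] := eqVneq c 0; first by rewrite normr0 mul0r quot_norm_ge0.
rewrite -ler_pdivlMl ?normr_gt0// -normfV.
by rewrite -[in leLHS](scale1r u) -(mulVf c0) -scalerA le_nZ.
Qed.

Fact quot_norm0_eq0 u : quot_norm u = 0 -> u = 0.
Proof.
case: (idealP J) => Kcl _ _ _ _.
elim/quot_ind: u => a a0; rewrite -quot_map0; apply/quot_mapP; rewrite subr0.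
apply: Kcl => B /nbhs_ballP[e /= e0 eB].
have e0' : 0 < complex.Re e by rewrite -ltcR -ge0_ReE ?ltW.
have [_ [b ba <-] be] := inf_adherent e0' (conj (quot_nonempty (quot_map a))
  (quot_has_lb (quot_map a))).
exists (a - b); split; first exact/quot_mapP.
apply: eB; rewrite -ball_normE /= opprB addrC subrK.
move: a0; rewrite /quot_norm => -[a0].
move: be; rewrite a0 add0r => be.
by rewrite (ge0_ReE (normr_ge0 b)) (ge0_ReE (ltW e0)) ltcR.
Qed.

HB.instance Definition _ := @Lmodule_isNormed.Build R[i] quot_alg quot_norm
  quot_normD quot_normZ quot_norm0_eq0.

Fact quotM_A : associative quotM.
Proof.
elim/quot_ind => u; elim/quot_ind => v; elim/quot_ind => w.
by rewrite !quotME smulA.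
Qed.
Fact quotM_Dl : left_distributive quotM +%R.
Proof.
elim/quot_ind => u; elim/quot_ind => v; elim/quot_ind => w.
by rewrite -quot_mapD !quotME smulDl quot_mapD.
Qed.
Fact quotM_Dr : right_distributive quotM +%R.
Proof.
elim/quot_ind => u; elim/quot_ind => v; elim/quot_ind => w.
by rewrite -quot_mapD !quotME smulDr quot_mapD.
Qed.
Fact quotM_Zl c u v : quotM (c *: u) v = c *: quotM u v.
Proof.
elim/quot_ind: u => u; elim/quot_ind: v => v.
by rewrite -quot_mapZ !quotME smulZl quot_mapZ.
Qed.
Fact quotM_Zr c u v : quotM u (c *: v) = c *: quotM u v.
Proof.
elim/quot_ind: u => u; elim/quot_ind: v => v.
by rewrite -quot_mapZ !quotME smulZr quot_mapZ.
Qed.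
Fact quot_norm_smul u v : `|quotM u v| <= `|u| * `|v|.
Proof.
apply: quot_norm_ge => //; first exact: quot_norm_real.
move=> b <-; rewrite mulrC; apply: quot_norm_ge => //.
  exact: quot_norm_real.
move=> a <-; rewrite quotME mulrC (le_trans (quot_norm_le _))//.
exact: norm_smul.
Qed.
Fact quotS_K : involutive quotS.
Proof. by elim/quot_ind => u; rewrite !quotSE starK. Qed.
Fact quotS_D : {morph quotS : u v / u + v}.
Proof.
elim/quot_ind => u; elim/quot_ind => v.
by rewrite -quot_mapD !quotSE starD quot_mapD.
Qed.
Fact quotS_Z c u : quotS (c *: u) = (c^*)%R *: quotS u.
Proof. by elim/quot_ind: u => u; rewrite -quot_mapZ !quotSE starZ quot_mapZ. Qed.
Fact quotS_M u v : quotS (quotM u v) = quotM (quotS v) (quotS u).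
Proof.
elim/quot_ind: u => u; elim/quot_ind: v => v.
by rewrite quotME !quotSE quotME starM.
Qed.
Fact quot_norm_star u : `|quotS u| = `|u|.
Proof.
have le_nS v : quot_norm (quotS v) <= quot_norm v.
  rewrite -[leRHS]mul1r; apply: quot_norm_ge; rewrite ?quot_norm_real//.
  move=> a <-; rewrite mul1r quotSE (le_trans (quot_norm_le _))//.
  by rewrite norm_star.
by apply/eqP; rewrite eq_le le_nS /= -[in leLHS](quotS_K u) le_nS.
Qed.

HB.instance Definition _ := isStarAlg.Build R quot_alg
  quotM_A quotM_Dl quotM_Dr quotM_Zl quotM_Zr quot_norm_smul
  quotS_K quotS_D quotS_Z quotS_M quot_norm_star.

Lemma quot_map_star_hom : star_hom quot_map.
Proof.
split=> [c a b|a b|a]; first by rewrite quot_mapD quot_mapZ.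
  by rewrite -quotME.
by rewrite -quotSE.
Qed.

End QuotientAlgebra.

(* C*(G): the smallest closed *-subalgebra containing G. *)
Definition gen_substar (R : realType) (E : starAlgType R) (G : set E) : set E :=
  smallest (@is_substar R E) G.

Fact gen_substarP (R : realType) (E : starAlgType R) (G : set E) :
  is_substar (gen_substar G).
Proof.
split.
- by apply: closed_bigI => S [[]].
- by move=> S [[]].
- by move=> c x y Gx Gy S [hS GS]; case: (hS) => _ _ SD _ _; apply: SD;
    [apply: Gx|apply: Gy].
- by move=> x y Gx Gy S [hS GS]; case: (hS) => _ _ _ SM _; apply: SM;
    [apply: Gx|apply: Gy].
- by move=> x Gx S [hS GS]; case: (hS) => _ _ _ _ SS; apply: SS; apply: Gx.
Qed.

Section C0Sum.
Variables (R : realType) (I : eqType) (E : I -> starAlgType R).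

Definition c0_set : set (bprod E) :=
  [set f | forall eps : R[i], 0 < eps -> finite_set [set i | eps <= `|f i|]].

Let half_split (eps a b : R[i]) : 0 < eps -> 0 <= a -> 0 <= b ->
  eps <= a + b -> eps / 2 <= a \/ eps / 2 <= b.
Proof.
move=> e0 a0 b0 eab.
have e2 : eps / 2 \is Num.real by rewrite gtr0_real ?divr_gt0.
have [|ae] := real_leP e2 (ger0_real a0); first by left.
have [|be] := real_leP e2 (ger0_real b0); first by right.
have := ltrD ae be; rewrite -splitr => abe.
by have := le_lt_trans eab abe; rewrite ltxx.
Qed.

Fact c0_substar : is_substar c0_set.
Proof.
split.
- move=> f fcl eps eps0; have e2 : 0 < eps / 2 by rewrite divr_gt0.
  have [g [gc0 fg]] := fcl _ (nbhsx_ballx f _ e2).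
  apply: sub_finite_set (gc0 _ e2) => i /= efi.
  have fgi : `|f i - g i| < eps / 2.
    rewrite -ball_normE /= in fg; apply: le_lt_trans fg.
    exact: (bprod_norm_ub (f - g)).
  have : eps <= `|f i - g i| + `|g i|.
    by rewrite (le_trans efi)// -{1}(subrK (g i) (f i)) ler_normD.
  case/(half_split eps0 (normr_ge0 _) (normr_ge0 _)) => // fgi'.
  by have := le_lt_trans fgi' fgi; rewrite ltxx.
- move=> eps eps0; apply: (sub_finite_set _ (finite_set0 I)) => i /=.
  by rewrite normr0 => /(lt_le_trans eps0); rewrite ltxx.
- move=> c f g fc0 gc0 eps eps0.
  have e2 : 0 < eps / 2 by rewrite divr_gt0.
  have c1 : 0 < `|c| + 1 by rewrite ltr_wpDl.
  have e3 : 0 < eps / 2 / (`|c| + 1) by rewrite divr_gt0.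
  apply: (sub_finite_set _ (_ : finite_set
      ([set i | eps / 2 / (`|c| + 1) <= `|f i|] `|` [set i | eps / 2 <= `|g i|]))).
    move=> i /= efg.
    have : eps <= `|c *: f i| + `|g i|.
      by rewrite (le_trans efg)// ler_normD.
    case/(half_split eps0 (normr_ge0 _) (normr_ge0 _)) => H; [left|by right].
    rewrite ler_pdivrMr// (le_trans H)// normrZ mulrC ler_wpM2l// lerDl.
    exact: ler01.
  by rewrite finite_setU; split; [exact: fc0|exact: gc0].
- move=> f g fc0 gc0 eps eps0.
  have c1 : 0 < `|g| + 1 by rewrite ltr_wpDl.
  apply: (sub_finite_set _ (fc0 (eps / (`|g| + 1)) (divr_gt0 eps0 c1))) => i /=.
  move=> efg; rewrite ler_pdivrMr// (le_trans efg)//.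
  rewrite (le_trans (norm_smul _ _))// ler_wpM2l//.
  by rewrite (le_trans (bprod_norm_ub g i))// lerDl ler01.
- move=> f fc0 eps eps0; apply: (sub_finite_set _ (fc0 _ eps0)) => i /=.
  by rewrite norm_star.
Qed.

Definition c0_sum := substar_type (SubStar c0_substar).

Fact c0_single_bounded (i : I) (u : E i) :
  exists M : R[i], forall j, `|dfwith (fun k => 0 : E k) i u j| <= M.
Proof.
exists `|u| => j; have [<-|ij] := eqVneq i j; first by rewrite dfwithin.
by rewrite dfwithout// normr0.
Qed.

Fact c0_single_c0 (i : I) (u : E i) : c0_set (BProd (c0_single_bounded u)).
Proof.
move=> eps eps0; apply: (sub_finite_set _ (finite_set1 i)) => j /=.
have [/esym//|ij] := eqVneq i j.
by rewrite dfwithout// normr0 => /(lt_le_trans eps0); rewrite ltxx.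
Qed.

Definition c0_single (i : I) (u : E i) : c0_sum :=
  @subelt _ _ (SubStar c0_substar) _ (c0_single_c0 u).

End C0Sum.

(* Actions of a commutative monoid by *-endomorphisms; if S is a group, these
   are automorphisms. *)
Definition is_action (R : realType) (S : nmodType) (E : starAlgType R)
    (act : S -> E -> E) : Prop :=
  [/\ forall s, star_hom (act s),
      forall a, act 0 a = a &
      forall s t a, act (s + t) a = act s (act t a)].

Notation zplus n := {ffun 'I_n -> nat}.
Notation zlat n := {ffun 'I_n -> int}.

Section Lattice.
Variable n : nat.

Definition lat_of (x : zplus n) : zlat n := [ffun i => (x i)%:Z].
Definition nonneg (g : zlat n) : bool := [forall i, 0 <= g i].
Definition abs_lat (g : zlat n) : zplus n := [ffun i => `|g i|%N].
Definition generator (i : 'I_n) : zplus n := [ffun j => (j == i) : nat].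
Definition supp (x : zplus n) : {set 'I_n} := [set i | (0 < x i)%N].
Definition lat_meet (x y : zplus n) : zplus n := [ffun i => minn (x i) (y i)].
Definition perp (x y : zplus n) : Prop := lat_meet x y = 0.

End Lattice.

Record unital_dynsys (R : realType) (A : cstarAlgType R) (n : nat) :=
  UnitalDynSys {
  dyn_act :> zplus n -> A -> A;
  dyn_actP : is_action dyn_act;
  dyn_one : A;
  dyn_one_l : forall a, dyn_one ** a = a;
  dyn_one_r : forall a, a ** dyn_one = a;
  dyn_act_one : forall x, dyn_act x dyn_one = dyn_one
}.

Section ProductDilation.
Variables (R : realType) (A : cstarAlgType R) (n : nat).
Variable alpha : unital_dynsys A n.

Lemma dyn_act_hom x : star_hom (alpha x).
Proof. by case: (dyn_actP alpha). Qed.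

Lemma dyn_act_norm x a : `|alpha x a| <= `|a|.
Proof.
exact: (norm_star_hom (dyn_one_l alpha) (dyn_one_r alpha) a (dyn_act_hom x)
  (dyn_act_one alpha x)).
Qed.

Lemma dyn_act_continuous x : continuous (alpha x).
Proof.
apply: (@lip_continuous _ _ _ _ 1) => // a b.
by rewrite mul1r -(star_homB (dyn_act_hom x)) dyn_act_norm.
Qed.

Fact prod_iota_bounded (a : A) : exists M : R[i], forall g : zlat n,
  `|if nonneg g then alpha (abs_lat g) a else 0| <= M.
Proof.
by exists `|a| => g; case: ifP => _; rewrite ?dyn_act_norm ?normr0.
Qed.

Definition prod_iota (a : A) : bprod (fun _ : zlat n => A) :=
  BProd (prod_iota_bounded a).

Fact prod_shift_bounded (g : zlat n) (f : bprod (fun _ : zlat n => A)) :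
  exists M : R[i], forall h, `|f (h + g)| <= M.
Proof. by case: (bfun_bounded f) => M fM; exists M. Qed.

Definition prod_shift (g : zlat n) (f : bprod (fun _ : zlat n => A)) :
    bprod (fun _ : zlat n => A) :=
  BProd (prod_shift_bounded g f).

Definition dil_gen : set (bprod (fun _ : zlat n => A)) :=
  [set f | exists g a, f = prod_shift g (prod_iota a)].

Definition dil_alg := substar_type (SubStar (gen_substarP dil_gen)).

Fact dil_iota_in a : gen_substar dil_gen (prod_iota a).
Proof.
apply: sub_gen_smallest; exists 0, a.
by apply: bprodP => g /=; rewrite addr0.
Qed.

Definition dil_iota (a : A) : dil_alg :=
  @subelt _ _ (SubStar (gen_substarP dil_gen)) _ (dil_iota_in a).

Lemma prod_shift_continuous g : continuous (prod_shift g).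
Proof.
apply: (@lip_continuous _ _ _ _ 1) => // x y; rewrite mul1r.
by apply: bprod_norm_le => // h; exact: (bprod_norm_ub (x - y)).
Qed.

Lemma prod_shift_hom g : star_hom (prod_shift g).
Proof. by split=> [c a b|a b|a]; apply: bprodP. Qed.

Fact dil_shift_in g (f : bprod (fun _ : zlat n => A)) :
  gen_substar dil_gen f -> gen_substar dil_gen (prod_shift g f).
Proof.
have [gcl g0 gD gM gS] := gen_substarP dil_gen.
suff : gen_substar dil_gen `<=` prod_shift g @^-1` gen_substar dil_gen by apply.
apply: smallest_sub; last first.
  move=> _ [h [a ->]]; apply: sub_gen_smallest; exists (g + h), a.
  by apply: bprodP => k /=; rewrite addrA.
split.
- by apply: preimage_closed => // x _; exact: prod_shift_continuous.
- by rewrite /preimage/= (star_hom0 (prod_shift_hom g)).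
- by move=> c x y gx gy; rewrite /preimage/= (star_homZD (prod_shift_hom g)); exact: gD.
- by move=> x y gx gy; rewrite /preimage/= (star_homM (prod_shift_hom g)); exact: gM.
- by move=> x gx; rewrite /preimage/= (star_homS (prod_shift_hom g)); exact: gS.
Qed.

Definition dil_shift (g : zlat n) (b : dil_alg) : dil_alg :=
  @subelt _ _ (SubStar (gen_substarP dil_gen)) _
    (dil_shift_in g (subval_in b)).

Definition invariant_boundary_ideal (J : set dil_alg) : Prop :=
  [/\ is_ideal J,
      forall a, J (dil_iota a) -> dil_iota a = 0 &
      forall g b, J b -> J (dil_shift g b)].

(* Maximality is with respect to inclusion; uniqueness is expressed below by
   [unique maximal_boundary_ideal I]. *)
Definition maximal_boundary_ideal (J : set dil_alg) : Prop :=
  invariant_boundary_ideal J /\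
  forall J', invariant_boundary_ideal J' -> J `<=` J' -> J' = J.

Fact star_invariant_boundary J : invariant_boundary_ideal J ->
  invariant_boundary_ideal [set b | J (star b)].
Proof.
move=> [[Jcl J0 JD Jl Jr] Ji Jb]; split; first split.
- by apply: preimage_closed => // x _; exact: star_continuous.
- by rewrite /= star0.
- by move=> c x y /= Jx Jy; rewrite starD starZ; exact: JD.
- by move=> a x /= Jx; rewrite starM; exact: Jr.
- by move=> a x /= Jx; rewrite starM; exact: Jl.
- move=> a /= Ja.
  have iS : star (dil_iota a) = dil_iota (star a).
    apply/val_inj; apply: bprodP => g /=.
    by case: ifP => _; rewrite ?star0// (star_homS (dyn_act_hom _)).
  by rewrite -[LHS]starK iS (Ji (star a)) ?star0// -iS.
- move=> g b /= Jb'; have -> : star (dil_shift g b) = dil_shift g (star b).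
    by apply/val_inj; apply: bprodP.
  exact: Jb.
Qed.

(* I^* is again a maximal invariant boundary ideal, hence equals I. *)
Lemma max_boundary_ideal_star I : unique maximal_boundary_ideal I ->
  forall b, I b -> I (star b).
Proof.
move=> [[Iinv Imax] Iuniq] b Ib.
have <- : [set b | I (star b)] = I; last by rewrite /= starK.
apply/esym/Iuniq; split; first exact: star_invariant_boundary.
move=> J Jinv IJ; have JsE : [set b | J (star b)] = I.
  apply: Imax; first exact: star_invariant_boundary.
  by move=> x Ix; apply: IJ; rewrite /= starK.
by apply/seteqP; split=> x; rewrite -JsE /= starK.
Qed.

Definition boundary_sideal I (hI : unique maximal_boundary_ideal I) :
    sideal dil_alg :=
  SIdeal (let: And3 idI _ _ := hI.1.1 in idI) (max_boundary_ideal_star hI).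

Definition boundary_quot I (hI : unique maximal_boundary_ideal I) :=
  quot_alg (boundary_sideal hI).

Section quotient_action.
Variables (I : set dil_alg) (hI : unique maximal_boundary_ideal I).

Definition quot_shift (g : zlat n) (u : boundary_quot hI) : boundary_quot hI :=
  quot_map (boundary_sideal hI) (dil_shift g (quot_repr u)).

Lemma quot_shiftE g b : quot_shift g (quot_map (boundary_sideal hI) b) =
  quot_map (boundary_sideal hI) (dil_shift g b).
Proof.
apply/quot_mapP.
rewrite (_ : _ - _ = dil_shift g (quot_repr (quot_map (boundary_sideal hI) b) - b)).
  by case: hI.1.1 => _ _; apply; exact: (quot_mapK (boundary_sideal hI)).
by apply/val_inj; apply: bprodP.
Qed.

End quotient_action.

End ProductDilation.

Arguments maximal_boundary_ideal {R A n alpha} J.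

Section DFK.
Variables (R : realType) (A : cstarAlgType R) (n : nat).
Variable alpha : unital_dynsys A n.

Definition annih (K : set A) : set A := [set a | forall b, K b -> a ** b = 0].

Fact annih_closed K : closed (annih K).
Proof.
rewrite (_ : annih K = \bigcap_(b in K) [set a | a ** b = 0])//.
by apply: closed_bigI => b _; apply: closed_preimage_eq0; exact: smulr_continuous.
Qed.

Fact annih_ideal K : (forall a x, K x -> K (a ** x)) -> is_ideal (annih K).
Proof.
move=> Kl; split.
- exact: annih_closed.
- by move=> b _; rewrite smul0l.
- by move=> c x y Kx Ky b Kb; rewrite smulDl smulZl Kx// Ky// scaler0 addr0.
- by move=> a x Kx b Kb; rewrite -smulA Kx// smul0r.
- by move=> a x Kx b Kb; rewrite -smulA Kx//; exact: Kl.
Qed.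

Fact annih_star K : (forall a x, K x -> K (a ** x)) ->
  forall a, annih K a -> annih K (star a).
Proof.
move=> Kl a Ka b Kb; apply/eqP; rewrite -normr_eq0 -sqrf_eq0 -cstarE.
by rewrite starM starK -!smulA Ka ?smul0r ?normr0//; exact: Kl.
Qed.

Definition dfk_Q0 (x : zplus n) : set A :=
  annih [set a | forall i, i \in supp x -> alpha (generator i) a = 0].

Definition dfk_Q (x : zplus n) : set A :=
  [set a | forall y, perp y x -> dfk_Q0 x (alpha y a)].

Let dfk_Q0_kernel x a b :
  (forall i, i \in supp x -> alpha (generator i) b = 0) ->
  forall i, i \in supp x -> alpha (generator i) (a ** b) = 0.
Proof.
by move=> b0 i xi; rewrite (star_homM (dyn_act_hom _ _)) b0// smul0r.
Qed.

Fact dfk_Q_ideal x : is_ideal (dfk_Q x).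
Proof.
have [Q0cl Q00 Q0D Q0l Q0r] : is_ideal (dfk_Q0 x).
  by apply: annih_ideal => a b; exact: dfk_Q0_kernel.
split.
- rewrite (_ : dfk_Q x = \bigcap_(y in [set y | perp y x]) (alpha y @^-1` dfk_Q0 x))//.
  apply: closed_bigI => y _; apply: preimage_closed => // a _.
  exact: dyn_act_continuous.
- by move=> y _; rewrite (star_hom0 (dyn_act_hom _ _)).
- move=> c a b Qa Qb y yx; rewrite (star_homZD (dyn_act_hom _ _)).
  by apply: Q0D; [exact: Qa|exact: Qb].
- move=> a b Qb y yx; rewrite (star_homM (dyn_act_hom _ _)).
  by apply: Q0l; exact: Qb.
- move=> a b Qb y yx; rewrite (star_homM (dyn_act_hom _ _)).
  by apply: Q0r; exact: Qb.
Qed.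

Fact dfk_Q_star x a : dfk_Q x a -> dfk_Q x (star a).
Proof.
move=> Qa y yx; rewrite (star_homS (dyn_act_hom _ _)).
by apply: annih_star; [move=> c b; exact: dfk_Q0_kernel|exact: Qa].
Qed.

Definition dfk_Q_sideal (x : zplus n) : sideal A :=
  SIdeal (dfk_Q_ideal x) (@dfk_Q_star x).

Definition dfk_alg := c0_sum (fun x : zplus n => quot_alg (dfk_Q_sideal x)).

(* The element of the direct sum with entry q_x(a) at x and 0 elsewhere. *)
Definition dfk_elt (x : zplus n) (a : A) : dfk_alg :=
  @c0_single _ _ (fun x : zplus n => quot_alg (dfk_Q_sideal x)) x
    (quot_map (dfk_Q_sideal x) a).

Definition dfk_action (gamma : zplus n -> dfk_alg -> dfk_alg) : Prop :=
  is_action gamma /\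
  forall (i : 'I_n) (x : zplus n) (a : A),
    (perp (generator i) x ->
      gamma (generator i) (dfk_elt x a) =
        dfk_elt x (alpha (generator i) a) + dfk_elt (x + generator i) a) /\
    (i \in supp x ->
      gamma (generator i) (dfk_elt x a) = dfk_elt (x + generator i) a).

Definition dfk_eta (a : A) : dfk_alg := dfk_elt 0 a.

End DFK.

(* The inclusion of C into Ct as a C*-subalgebra is the isometric
   *-homomorphism j. *)
Definition minimal_automorphic_extension (R : realType) (n : nat)
    (C Ct : starAlgType R) (gamma : zplus n -> C -> C)
    (gammat : zlat n -> Ct -> Ct) (j : C -> Ct) : Prop :=
  [/\ is_action gammat,
      star_hom j /\ (forall c, `|j c| = `|c|),
      forall x c, gammat (lat_of x) (j c) = j (gamma x c) &
      closure (\bigcup_(x in [set: zplus n]) (gammat (- lat_of x) @` range j)) =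
        [set: Ct]].

Definition star_iso (R : realType) (E F : starAlgType R) (f : E -> F) : Prop :=
  star_hom f /\ bijective f.

(* Main.v *)
Require Import Defs.
From mathcomp Require Import all_boot all_order all_algebra complex.
From mathcomp Require Import all_classical all_reals topology normedtype.
From mathcomp Require Import finmap sequences zify ring lra.

(* For f in c_0(Z^n_+, A), put sigma(f)_h = alpha_{h+}(f_{h-}) for h in Z^n.
   This isometric *-homomorphism maps onto C^*(beta_x iota(A) : x >= 0), so that
   B is the closure of the union of the beta_{-x} sigma(c_0(Z^n_+, A)). Since
   the coordinatewise quotient map q : c_0(Z^n_+, A) -> C intertwines the maps
   induced by beta_i and gamma_i, the assignment
   beta_{-x} sigma(f) |-> gammat_{-x} q(f) extends to an equivariant
   *-homomorphism pi : B -> Ct. Coordinatewise lifts of bounded norm make pi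
   surjective.
   It remains to see that ker pi, itself an invariant boundary ideal, contains
   every invariant boundary ideal J. If a in A sits at the coordinate -y of sigma and lies in J, multiplying a shift
   of it by iota(c), with c killed by alpha_i for i in supp(y), gives
   iota(alpha_z(a) c) in J, hence a in Q_y. So the kernel of A -> B/J, taking a
   to that coordinate, is contained in Q_y; as for injective *-homomorphisms,
   the norm of a in A/Q_y is then controlled by its distance to J. Hence q(f) is
   small whenever beta_{-x} sigma(f) is close to an element of J. *)

Import Order.TTheory GRing.Theory Num.Theory.
Import numFieldNormedType.Exports.

Local Open Scope classical_set_scope.
Local Open Scope ring_scope.

Set Implicit Arguments.
Unset Strict Implicit.
Unset Printing Implicit Defensive.

(** * Elementary C*-theory *)

(** The hypothesis makes [s] nondecreasing; telescoping bounds [u (m + p) - u m] by an increment of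
    [s], hence by the tail [limn s - s m], and the same tail survives in the limit. The rate depends
    on [s] alone. *)
Lemma cvg_majorized (R : realType) (V : completeNormedModType R[i])
    (u : nat -> V) (s : nat -> R) :
  (forall m, `|u m.+1 - u m| <= (s m.+1 - s m)%:C%C) -> cvgn s ->
  exists l, forall m, `|l - u m| <= (limn s - s m)%:C%C.
Proof.
move=> us cs.
have s_homo : {homo s : m p / (m <= p)%N >-> m <= p}.
  apply: homo_leq => [x|y x z|m]; [exact: lexx|exact: le_trans|].
  by rewrite -subr_ge0 -lecR (le_trans (normr_ge0 _) (us m)).
have us_dist m p : `|u (m + p)%N - u m| <= (s (m + p)%N - s m)%:C%C.
  elim: p => [|p ih]; first by rewrite addn0 !subrr normr0.
  rewrite addnS -(subrK (u (m + p)%N) (u _.+1)) -addrA.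
  rewrite -(subrK (s (m + p)%N) (s _.+1)) -[in leRHS]addrA rmorphD.
  by rewrite (le_trans (ler_normD _ _))// lerD.
have u_bnd m p : `|u (m + p)%N - u m| <= (limn s - s m)%:C%C.
  by rewrite (le_trans (us_dist m p))// lecR lerD2r nondecreasing_cvgn_le.
have : cvgn u.
  apply: cauchy_cvg; apply: cauchy_exP => e e0.
  have eE := ge0_ReE (ltW e0).
  have e0' : 0 < complex.Re e by rewrite -ltcR -eE.
  have /cvgrPdist_lt /(_ _ e0') [N _ /(_ N (leqnn N))/= sN] := cs.
  exists (u N); exists N => // m /= Nm.
  rewrite -ball_normE /= distrC -(subnKC Nm) (le_lt_trans (u_bnd _ _))//.
  by rewrite eE ltcR (le_lt_trans (ler_norm _)).
move=> /cvg_ex[l ul]; exists l => m.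
apply/ler_addgt0Pr => e /= e0.
have /cvgrPdist_lt /(_ _ e0) [N _ /(_ (m + N)%N (leq_addl _ _))/= ulN] := ul.
rewrite -(subrK (u (m + N)%N) l) -addrA (le_trans (ler_normD _ _))//.
rewrite [leRHS]addrC; apply: lerD; [exact: ltW|exact: u_bnd].
Qed.

Section cstar_elementary.
Variable R : realType.

(* With c = p + i w one has c^* c = v^* v, and 2 p = c + (p - i w). *)
Lemma norm_le_pythagoras (F : cstarAlgType R) (p w v : F) :
  star p ** p + star w ** w = star v ** v -> star p ** w = star w ** p ->
  `|p| <= `|v|.
Proof.
move=> pwv pw.
have norm_u (c : R[i]) : c * c^* = 1 -> c^* = - c -> `|p + c *: w| <= `|v|.
  move=> cc cN; rewrite -(@ler_pXn2r _ 2)// ?nnegrE// -!cstarE -pwv.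
  rewrite starD starZ !smulDl !smulDr !smulZl !smulZr pw scalerA.
  rewrite (mulrC c^*) cc scale1r cN scaleNr addrA addrAC -addrA.
  by rewrite addrACA subrr addr0 lexx.
have iconj : ('i : R[i])^* = - 'i by rewrite conjCi.
have h1 : `|p + 'i *: w| <= `|v|.
  by apply: norm_u; rewrite ?iconj// mulrN -expr2 sqrCi opprK.
have h2 : `|p + (- 'i) *: w| <= `|v|.
  by apply: norm_u; rewrite rmorphN /= iconj// opprK mulNr -expr2 sqrCi opprK.
have : `|p + p| <= `|v| + `|v|.
  have -> : p + p = (p + 'i *: w) + (p + (- 'i) *: w).
    by rewrite scaleNr addrACA subrr addr0.
  by rewrite (le_trans (ler_normD _ _))// lerD.
by rewrite -!mulr2n normrMn lerMn2r.
Qed.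

Section square_root.
Variables (E : cstarAlgType R) (k : E).
Hypotheses (k_sa : star k = k) (k_le1 : `|k| <= 1).

(** The scalar case [k = 1] of the iteration [z]. Its increments dominate those of [z], which gives
    convergence even for [|k| = 1], where no geometric rate is available. *)
Let s := fix F (m : nat) : R :=
  if m is m'.+1 then 2^-1 * (1 + F m' ^+ 2) else 0.
Let z := fix F (m : nat) : E :=
  if m is m'.+1 then 2^-1 *: (k + F m' ** F m') else 0.

Let s01 m : 0 <= s m <= 1.
Proof.
elim: m => [|m /andP[s0 s1]]; first by rewrite lexx ler01.
by apply/andP; split=> /=; nra.
Qed.

Let sS m : s m.+1 = 2^-1 * (1 + s m ^+ 2).
Proof. by []. Qed.

Let zS m : z m.+1 = 2^-1 *: (k + z m ** z m).
Proof. by []. Qed.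

Let s_cvg : cvgn s.
Proof.
apply: nondecreasing_is_cvgn.
  apply: homo_leq => [x|y x z'|m]; [exact: lexx|exact: le_trans|].
  by rewrite sS; have /andP[] := s01 m; nra.
by exists 1 => _ [m _ <-]; case/andP: (s01 m).
Qed.

Let norm_half (x : E) : `|2^-1 *: x| = (2^-1)%:C%C * `|x|.
Proof.
by rewrite normrZ fmorphV rmorphMn rmorph1 ger0_norm// invr_ge0 ler0n.
Qed.

Let z_le m : `|z m| <= (s m)%:C%C.
Proof.
elim: m => [|m ih]; first by rewrite normr0.
have /andP[s0 _] := s01 m.
rewrite zS sS norm_half rmorphM ler_wpM2l ?lecR ?invr_ge0//.
rewrite (le_trans (ler_normD _ _))// rmorphD rmorphXn rmorph1 lerD//.
by rewrite (le_trans (norm_smul _ _))// expr2 ler_pM.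
Qed.

Let z_step m : `|z m.+1 - z m| <= (s m.+1 - s m)%:C%C.
Proof.
elim: m => [|m ih].
  by rewrite subr0 [s 0]/= subr0 z_le.
rewrite (zS m.+1) [X in _ - X]zS -scalerBr norm_half.
(* The scalar difference of squares is split as the noncommutative one must be, so that the two
   compare term by term. *)
have -> : s m.+2 - s m.+1 =
    2^-1 * (s m.+1 * (s m.+1 - s m) + (s m.+1 - s m) * s m).
  by rewrite !sS; ring.
move: ih (z_le m.+1) (z_le m); move: (s m.+1) (s m) => t t' ih zt zt'.
rewrite rmorphM ler_wpM2l ?lecR ?invr_ge0// rmorphD !rmorphM.
have -> : k + z m.+1 ** z m.+1 - (k + z m ** z m) =
    z m.+1 ** (z m.+1 - z m) + (z m.+1 - z m) ** z m.
  by rewrite smulBr smulBl addrA subrK opprD addrACA subrr add0r.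
rewrite (le_trans (ler_normD _ _))// lerD// (le_trans (norm_smul _ _))//.
  by rewrite ler_pM.
by rewrite ler_pM.
Qed.

(* Formally 1 - a is the positive square root of 1 - k. *)
Lemma exists_sqrt_one_sub : exists a : E,
  [/\ star a = a, `|a| <= 1, a + a = k + a ** a &
  forall x, k ** x = x ** k -> a ** x = x ** a].
Proof.
have [a aP] := cvg_majorized z_step s_cvg.
have za : z m @[m --> \oo] --> a.
  apply/cvgrPdist_lt => e e0; have eE := ge0_ReE (ltW e0).
  have e0' : 0 < complex.Re e by rewrite -ltcR -eE.
  have /cvgrPdist_lt /(_ _ e0') [N _ sN] := s_cvg; exists N => // m /sN /= smN.
  rewrite (le_lt_trans (aP m))// eE ltcR (le_lt_trans _ smN)//.
  exact: ler_norm.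
have a_in (f : E -> E) : continuous f -> (forall m, f (z m) = 0) -> f a = 0.
  move=> fc f0; apply: (closed_cvg [set x | f x = 0] _ _ _ za).
    exact: closed_preimage_eq0.
  exact: nearW.
have a_comm x : k ** x = x ** k -> a ** x = x ** a.
  move=> kx; apply/subr0_eq; apply: (a_in (fun y => y ** x - x ** y)).
    move=> y; apply: cvgB; [exact: smulr_continuous|exact: smull_continuous].
  move=> m; apply/eqP; rewrite subr_eq0; apply/eqP.
  elim: m => [|m ih]; first by rewrite smul0l smul0r.
  rewrite zS smulZl smulZr smulDl smulDr kx; congr (_ *: (_ + _)).
  by rewrite -smulA ih !smulA ih.
exists a; split=> //.
- apply/subr0_eq; apply: (a_in (fun x => star x - x)).
    move=> x; apply: cvgB; [exact: star_continuous|exact: cvg_id].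
  move=> m; apply/eqP; rewrite subr_eq0; apply/eqP.
  elim: m => [|m ih]; first by rewrite star0.
  by rewrite zS starZ starD !starM ih k_sa fmorphV rmorph_nat.
(* Both iterations start at 0, so the error bound at 0 reads [|a| <= limn s], and [s] never exceeds
   1. *)
- have := aP 0; rewrite !subr0 => /le_trans; apply.
  rewrite -[1]/(1%:C%C) lecR; apply: limr_le => //.
  by apply: nearW => m; case/andP: (s01 m).
- have l1 : 2 *: z m.+1 @[m --> \oo] --> 2 *: a.
    by apply: cvgZl_tmp; rewrite cvg_shiftS.
  have l2 : 2 *: z m.+1 @[m --> \oo] --> k + a ** a.
    rewrite (_ : (fun m => _) = fun m => k + z m ** z m); last first.
      by apply/funext => m; rewrite zS scalerA mulfV ?scale1r// pnatr_eq0.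
    apply: cvgD; first exact: cvg_cst.
    apply/cvgrPdist_lt => d d0.
    have M0 : 0 < `|a| + 1 by rewrite ltr_wpDl.
    near=> m; have zm : `|a - z m| < d / (`|a| + 1).
      by near: m; move/cvgrPdist_lt : za; apply; rewrite divr_gt0.
    have -> : a ** a - z m ** z m = a ** (a - z m) + (a - z m) ** z m.
      by rewrite smulBr smulBl addrA subrK.
    rewrite (le_lt_trans (ler_normD _ _))//.
    apply: (@le_lt_trans _ _ (`|a - z m| * (`|a| + 1))).
      rewrite mulrDr lerD//; first by rewrite mulrC norm_smul.
      rewrite (le_trans (norm_smul _ _))// ler_wpM2l//.
      by rewrite (le_trans (z_le m))// -[1]/(1%:C%C) lecR; case/andP: (s01 m).
    by rewrite -ltr_pdivlMr.
  by rewrite -mulr2n -scaler_nat; exact: (cvg_unique _ l1 l2).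
Unshelve. all: by end_near. Qed.

End square_root.

(** In the absence of a unit, [h - a ** h] stands for h times the square root of 1 - h^2. The images
    p = f(h)^2 and w = f(h) - f(a) f(h) satisfy p^2 + w^* w = f(h)^2, so |f(h)|^2 <= |f(h)| for
    selfadjoint h in the unit ball. The C*-identity and scaling give the general case. *)
Lemma star_hom_contractive (E F : cstarAlgType R) (f : E -> F) (x : E) :
  star_hom f -> `|f x| <= `|x|.
Proof.
move=> hf.
have sa_le1 h : star h = h -> `|h| <= 1 -> `|f h| <= 1.
  move=> h_sa h1.
  have hh1 : `|h ** h| <= 1.
    by rewrite (le_trans (norm_smul _ _))// -[1]mulr1 ler_pM.
  have hh_sa : star (h ** h) = h ** h by rewrite starM h_sa.
  have [a [a_sa _ a2 a_comm]] := exists_sqrt_one_sub hh_sa hh1.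
  have ah : a ** h = h ** a by apply: a_comm; rewrite smulA.
  have fa2 : f a + f a = f h ** f h + f a ** f a.
    by rewrite -!(star_homM hf) -!(star_homD hf) a2.
  have fa_sa : star (f a) = f a by rewrite -(star_homS hf) a_sa.
  have fh_sa : star (f h) = f h by rewrite -(star_homS hf) h_sa.
  have fah : f a ** f h = f h ** f a by rewrite -!(star_homM hf) ah.
  have : `|f h ** f h| <= `|f h|.
    apply: (@norm_le_pythagoras _ _ (f h - f a ** f h)).
      rewrite starB !starM fa_sa fh_sa smulBl !smulBr opprB.
      have -> : f h ** f a ** (f a ** f h) = f h ** (f a ** f a) ** f h.
        by rewrite !smulA.
      have -> : f a ** f a = f a + f a - f h ** f h by rewrite fa2 addrC addKr.
      rewrite smulBr smulBl smulDr smulDl !smulA.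
      set p := f h ** f h ** f h ** f h; set q := f h ** f a ** f h.
      by rewrite addrC (addrAC (q + q)) addrK addrA subrK subrK.
    rewrite starB !starM fa_sa fh_sa smulBr smulBl !smulA.
    congr (_ - _); rewrite -!smulA; congr (_ ** _).
    by rewrite smulA -fah smulA.
  rewrite -{1}fh_sa cstarE expr2.
  have [->|fh0] := eqVneq `|f h| 0; first by rewrite ler01.
  by move=> fhh; rewrite -(@ler_pM2r _ `|f h|) ?mul1r// lt_def fh0 normr_ge0.
have unit_le1 y : `|y| <= 1 -> `|f y| <= 1.
  move=> y1; rewrite -(@ler_pXn2r _ 2)// ?nnegrE// expr1n -cstarE.
  rewrite -(star_homS hf) -(star_homM hf) sa_le1 ?starM ?starK// cstarE.
  by rewrite exprn_ile1.
have [->|x0] := eqVneq x 0; first by rewrite (star_hom0 hf) !normr0.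
have nx0 : 0 < `|x| by rewrite normr_gt0.
have : `|f (`|x|^-1 *: x)| <= 1.
  by apply: unit_le1; rewrite normrZ normfV normr_id mulVf// gt_eqF.
by rewrite (star_homZ hf) normrZ normfV normr_id mulrC ler_pdivrMr// mul1r.
Qed.

End cstar_elementary.

Lemma closed_approx (K : numFieldType) (V : normedModType K) (S : set V) b :
  closed S -> (forall e : K, 0 < e -> exists2 x, S x & `|b - x| < e) -> S b.
Proof.
move=> Scl Sb; apply: Scl => U /nbhs_ballP[e /= e0 eU].
by have [x Sx bx] := Sb e e0; exists x; split=> //; apply: eU; rewrite -ball_normE.
Qed.

Lemma closure_approx (K : numFieldType) (V : normedModType K) (S : set V) b
    (e : K) : closure S b -> 0 < e -> exists2 x, S x & `|b - x| < e.
Proof.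
move=> Sb e0; have [x [Sx bx]] := Sb _ (nbhsx_ballx b _ e0).
by exists x => //; move: bx; rewrite -ball_normE.
Qed.

Lemma expr_small (R : realType) (c d : R[i]) : 0 <= c < 1 -> 0 < d ->
  exists m, c ^+ m < d.
Proof.
move=> /andP[c0 c1] d0; have cE := ge0_ReE c0; have dE := ge0_ReE (ltW d0).
have rc1 : `|complex.Re c| < 1.
  by rewrite ger0_norm -1?ltcR -1?lecR -?cE.
have d0' : 0 < complex.Re d by rewrite -ltcR -dE.
have /cvgrPdist_lt /(_ _ d0') [N _ /(_ N (leqnn N))] := cvg_expr rc1.
rewrite sub0r normrN /= => cN; exists N.
by rewrite dE cE -rmorphXn ltcR; apply: le_lt_trans cN; exact: ler_norm.
Qed.

(* [b - w^m b] lies in [J] for all [m], and [w^m b] tends to 0. *)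
Lemma ideal_contraction (R : realType) (B : starAlgType R) (J : set B) (w b : B) :
  is_ideal J -> `|w| < 1 -> J (b - w ** b) -> J b.
Proof.
move=> [Jcl J0 JD Jl Jr] w1 Jb.
have Jm m : J (b - iter m (smul w) b).
  elim: m => [|m ih]; first by rewrite subrr.
  have -> : b - iter m.+1 (smul w) b =
      1 *: (w ** (b - iter m (smul w) b)) + (b - w ** b).
    by rewrite scale1r smulBr [RHS]addrC addrA subrK.
  by apply: JD => //; exact: Jl.
have norm_m m : `|iter m (smul w) b| <= `|w| ^+ m * `|b|.
  elim: m => [|m ih]; first by rewrite expr0 mul1r.
  by rewrite (le_trans (norm_smul _ _))// exprS -mulrA ler_wpM2l.
apply: closed_approx => // e e0.
have b1 : 0 < `|b| + 1 by rewrite ltr_wpDl.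
have w01 : 0 <= `|w| < 1 by rewrite normr_ge0 w1.
have [m wm] := expr_small w01 (divr_gt0 e0 b1).
exists (b - iter m (smul w) b) => //; rewrite opprB addrC subrK.
rewrite (le_lt_trans (norm_m m))// (@le_lt_trans _ _ (`|w| ^+ m * (`|b| + 1)))//.
  by rewrite ler_wpM2l ?exprn_ge0// lerDl.
by rewrite -ltr_pdivlMr.
Qed.

(** * Norms in a quotient controlled by the distance to an ideal *)

Section quotient_norm_bound.
Variables (R : realType) (A F : cstarAlgType R) (B : starAlgType R) (e : A).
Hypotheses (e1l : forall a, e ** a = a) (e1r : forall a, a ** e = a).
Variables (phi : A -> B) (q : A -> F) (J : set B).
Hypotheses (phi_hom : star_hom phi) (phi_le : forall a, `|phi a| <= `|a|).
Hypotheses (q_hom : star_hom q) (J_ideal : is_ideal J).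
Hypothesis phi_q : forall a, J (phi a) -> q a = 0.

Let e_sa : star e = e := star_unit e1r.
Let e_le1 : `|e| <= 1 := norm_unit_le1 e1l e1r.

(** With a unit at hand, the [a] of [exists_sqrt_one_sub] yields an actual square root [e - a] of
    [e - k]. *)
Let sub_sq (a k : A) : a + a = k + a ** a -> (e - a) ** (e - a) = e - k.
Proof.
move=> aa; rewrite smulBl !smulBr !e1l e1r opprB.
have -> : a ** a = a + a - k by rewrite aa addrC addKr.
by rewrite (addrAC (a + a)) addrK addrA subrK.
Qed.

Let norm_sub_le1 (h a : A) : star h = h -> star a = a -> a ** h = h ** a ->
  a + a = h ** h + a ** a -> `|e - a| <= 1.
Proof.
move=> h_sa a_sa ah aa; apply: (le_trans _ e_le1).
apply: (@norm_le_pythagoras _ _ _ h).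
  by rewrite starB !e_sa a_sa h_sa (sub_sq aa) subrK e1l.
by rewrite starB !e_sa a_sa h_sa smulBl smulBr e1l e1r ah.
Qed.

(* With s = 1 - x^2, beta = |s| / m^2 and sg = s / m^2, the element
   g = beta - sg is a multiple of the positive part of x^2 - 1; it satisfies
   (m^2 + 1) g = m^2 (1 - beta) g + x^2 g, so phi g is in J, whence
   q(s) = |q(s)|, that is, q(x)^2 <= 1. *)
Let norm_sa_le1 (x : A) (u : B) : star x = x -> J u ->
  `|phi (x ** x) - u| < 1 -> `|q x| <= 1.
Proof.
move=> x_sa Ju xu; case: J_ideal => Jcl J0 JD Jl Jr.
pose s := e - x ** x.
have s_sa : star s = s by rewrite starB e_sa starM x_sa.
have sx : s ** x = x ** s by rewrite smulBl smulBr e1l e1r smulA.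
(* This choice gives |s| <= m <= m^2, hence [|sg| <= 1]. Scaling by a square lets [m *: l] be a root
   of m^2 [beta] at the end. *)
pose m := `|s| + 1.
have m1 : 1 <= m by rewrite lerDr.
have m0 : 0 < m by rewrite (lt_le_trans ltr01).
have mm : m^* = m by rewrite conj_Creal// gtr0_real.
have mm0 : 0 < m * m by rewrite mulr_gt0.
pose sg := (m * m)^-1 *: s.
have sgx : sg ** x = x ** sg by rewrite smulZl smulZr sx.
have sg_sa : star sg = sg by rewrite starZ s_sa fmorphV rmorphM /= mm.
have sg1 : `|sg| <= 1.
  rewrite normrZ normfV (gtr0_norm mm0) ler_pdivrMl// mulr1.
  rewrite (@le_trans _ _ m)//; first by rewrite lerDl.
  by rewrite ler_peMr// ltW.
have sgsg1 : `|sg ** sg| <= 1.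
  by rewrite (le_trans (norm_smul _ _))// -[1]mulr1 ler_pM.
have sgsg_sa : star (sg ** sg) = sg ** sg by rewrite starM sg_sa.
(* The root [a1] only serves to bound [k2] by 1, through [k2] = (e - a1)^2. *)
have [a1 [a1_sa _ a1E a1c]] := exists_sqrt_one_sub sgsg_sa sgsg1.
have a1sg : a1 ** sg = sg ** a1 by apply: a1c; rewrite smulA.
have na1 := norm_sub_le1 sg_sa a1_sa a1sg a1E.
pose k2 := e - sg ** sg.
have k2_sa : star k2 = k2 by rewrite starB e_sa sgsg_sa.
have k21 : `|k2| <= 1.
  rewrite /k2 -(sub_sq a1E) (le_trans (norm_smul _ _))//.
  by rewrite -[1]mulr1 ler_pM.
(* Now [e - a2] is the square root of [e - k2] = sg^2, that is, the absolute value of [sg]. *)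
have [a2 [a2_sa a21 a2E a2c]] := exists_sqrt_one_sub k2_sa k21.
have a2sg : a2 ** sg = sg ** a2.
  by apply: a2c; rewrite smulBl smulBr e1l e1r smulA.
have a2x : a2 ** x = x ** a2.
  by apply: a2c; rewrite smulBl smulBr e1l e1r -smulA sgx !smulA sgx.
pose beta := e - a2.
have beta2 : beta ** beta = sg ** sg.
  by rewrite /beta (sub_sq a2E) /k2 opprB addrC subrK.
have betasg : beta ** sg = sg ** beta.
  by rewrite smulBl smulBr e1l e1r a2sg.
(* One more root: [e - a3] squares to [e - a2]. *)
have [a3 [a3_sa _ a3E a3c]] := exists_sqrt_one_sub a2_sa a21.
pose l := e - a3.
have l_sa : star l = l by rewrite starB e_sa a3_sa.
have ll : l ** l = beta by rewrite /l (sub_sq a3E).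
have lx : l ** x = x ** l.
  by rewrite smulBl smulBr e1l e1r (a3c x).
pose g := beta - sg.
have [sE betaE g_def] : [/\ s = e - x ** x, beta = e - a2 & g = beta - sg] by [].
have msg : (m * m) *: sg = s.
  by rewrite scalerA mulfV ?scale1r// gt_eqF.
clearbody g l beta k2 sg m s.
(* On [g], which lives where [sg] is negative, |sg| acts as -sg. *)
have betag : beta ** g = - (sg ** g).
  by rewrite g_def !smulBr beta2 betasg opprB.
have gE : (m * m + 1) *: g = (m * m) *: (a2 ** g) + (x ** x) ** g.
  have : (m * m) *: (beta ** g) + s ** g = 0.
    by rewrite betag -msg smulZl scalerN addNr.
  rewrite betaE sE !smulBl !e1l scalerBr => /eqP.
  by rewrite addrACA -opprD subr_eq0 -[X in _ + X == _]scale1r -scalerDl => /eqP.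
have mm1 : 0 < m * m + 1 by rewrite addr_gt0.
(* The summands have norms at most m^2 and less than 1, so |w| < 1. Modulo J, multiplication by [w]
   fixes [phi g], because [u] lies in J. *)
pose w := (m * m + 1)^-1 *: ((m * m) *: phi a2 + (phi (x ** x) - u)).
have Jg : J (phi g).
  apply: (@ideal_contraction _ _ _ w) => //.
    rewrite normrZ normfV (ger0_norm (ltW mm1)) ltr_pdivrMl// mulr1.
    rewrite (le_lt_trans (ler_normD _ _))// ler_ltD// normrZ.
    by rewrite (gtr0_norm mm0) ler_piMr ?(ltW mm0)// (le_trans (phi_le _)).
  have -> : phi g - w ** phi g = (m * m + 1)^-1 *: (u ** phi g) + 0.
    rewrite addr0; apply: (scalerI (_ : m * m + 1 != 0)); first by rewrite gt_eqF.
    rewrite /w smulZl scalerBr !scalerA mulfV ?gt_eqF// !scale1r.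
    rewrite -(star_homZ phi_hom) gE (star_homD phi_hom) (star_homZ phi_hom).
    rewrite !(star_homM phi_hom) smulDl smulBl smulZl opprD addrACA subrr add0r.
    by rewrite opprB addrC subrK.
  by apply: JD => //; exact: Jr.
have qg : q beta = q sg.
  by apply/eqP; rewrite -subr_eq0 -(star_homB q_hom) -g_def; apply/eqP/phi_q.
apply: (le_trans _ e_le1); apply: (le_trans _ (star_hom_contractive e q_hom)).
(* Here q(x)^2 + (m q(l))^2 = q(x^2 + s) = q(e). *)
apply: (@norm_le_pythagoras _ _ _ (m *: q l)).
  rewrite starZ mm -!(star_homS q_hom) x_sa l_sa e_sa smulZl smulZr scalerA.
  rewrite -!(star_homM q_hom) ll qg -(star_homZ q_hom) msg.
  by rewrite -(star_homD q_hom) sE addrC subrK e1l.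
rewrite starZ mm -!(star_homS q_hom) x_sa l_sa smulZl smulZr.
by rewrite -!(star_homM q_hom) lx.
Qed.

Lemma quotient_norm_bound (a : A) (u : B) (r : R[i]) : J u -> 0 < r ->
  `|a| ^+ 3 * `|phi a - u| < r ^+ 4 -> `|q a| <= r.
Proof.
move=> Ju r0 au; have r1 : `|r^-1| = r^-1 by rewrite ger0_norm// invr_ge0 ltW.
case: J_ideal => _ _ _ Jl _.
suff : `|q (r^-1 *: a)| <= 1.
  by rewrite (star_homZ q_hom) normrZ r1 ler_pdivrMl// mulr1.
set b := r^-1 *: a.
rewrite -(@ler_pXn2r _ 2)// ?nnegrE// expr1n -cstarE -(star_homS q_hom).
rewrite -(star_homM q_hom).
apply: (@norm_sa_le1 _ (phi (star b ** b ** star b) ** (r^-1 *: u))).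
- by rewrite starM starK.
- apply: Jl; rewrite -[_ *: _]addr0; case: J_ideal => _ J0 JD _ _; exact: JD.
- rewrite smulA (star_homM phi_hom) -smulBr (star_homZ phi_hom) -scalerBr.
  rewrite (le_lt_trans (norm_smul _ _))//.
  have nb : `|phi (star b ** b ** star b)| <= (r^-1 * `|a|) ^+ 3.
    rewrite (le_trans (phi_le _))// (le_trans (norm_smul _ _))// cstarE.
    by rewrite norm_star -exprSr normrZ r1.
  rewrite (le_lt_trans (ler_wpM2r (normr_ge0 _) nb))// normrZ r1.
  have -> : (r^-1 * `|a|) ^+ 3 * (r^-1 * `|phi a - u|) =
      (r ^+ 4)^-1 * (`|a| ^+ 3 * `|phi a - u|).
    by rewrite -exprVn; ring.
  by rewrite ltr_pdivrMl ?exprn_gt0// mulr1.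
Qed.

End quotient_norm_bound.

(** * Extension by density and surjectivity *)

Lemma exists_min_gt0 (K : numFieldType) (d e : K) : 0 < d -> 0 < e ->
  exists m, [/\ 0 < m, m <= d & m <= e].
Proof.
move=> d0 e0; have /orP[de|ed] : (d <= e) || (e <= d).
  by rewrite real_leVge ?gtr0_real.
  by exists d.
by exists e.
Qed.

Section extension.
Variables (R : realType) (B : starAlgType R) (F : cstarAlgType R).
(** The graph of a densely defined contraction, kept as a relation: single-valuedness follows from
    [GZD] and [G_le] and need not be settled when the graph is built. *)
Variable G : B -> F -> Prop.
Hypotheses
  (GZD : forall c b f b' f', G b f -> G b' f' -> G (c *: b + b') (c *: f + f'))
  (GM : forall b f b' f', G b f -> G b' f' -> G (b ** b') (f ** f'))
  (GS : forall b f, G b f -> G (star b) (star f))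
  (G_le : forall b f, G b f -> `|f| <= `|b|)
  (G_dense : forall b (e : R[i]), 0 < e -> exists b' f', G b' f' /\ `|b - b'| < e).

Let G_dist b f b' f' : G b f -> G b' f' -> `|f - f'| <= `|b - b'|.
Proof.
move=> Gb Gb'; apply: G_le; rewrite -scaleN1r addrC -[in X in G _ X]scaleN1r.
by rewrite [f + _]addrC; exact: GZD.
Qed.

(** The values of the graph at points near [b] generate a Cauchy filter; its limit is the value at
    [b]. *)
Let ext_exists b : exists c : F, forall b' f', G b' f' -> `|c - f'| <= `|b - b'|.
Proof.
pose near_b (e : R[i]) := [set f | exists2 b', G b' f & `|b - b'| < e].
pose filt := filter_from [set e : R[i] | 0 < e] near_b.
have filt_proper : ProperFilter filt.
  apply: filter_from_proper; last first.
    by move=> e /= e0; have [b' [f' [Gb bb]]] := G_dense b e0; exists f', b'.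
  apply: filter_from_filter; first by exists 1 => /=.
  move=> e e' /= e0 e'0; have [m [m0 me me']] := exists_min_gt0 e0 e'0.
  by exists m => // f [b' Gb bb]; split; exists b'; rewrite ?(lt_le_trans bb).
have : cvg filt.
  apply: cauchy_cvg; apply: cauchy_exP => e e0.
  have e2 : 0 < e / 2 by rewrite divr_gt0.
  have [b1 [f1 [Gb1 bb1]]] := G_dense b e2.
  exists f1; exists (e / 2) => // f [b' Gb' bb'].
  rewrite -ball_normE /= (le_lt_trans (G_dist Gb1 Gb'))// (splitr e).
  rewrite (le_lt_trans (ler_distD b _ _))// ltrD//.
  by rewrite distrC.
move=> /cvg_ex[c filt_c]; exists c => b' f' Gb'; apply/ler_addgt0Pr => e /= e0.
have e2 : 0 < e / 2 by rewrite divr_gt0.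
have [d /= d0 dc] := filt_c _ (nbhsx_ballx c _ e2).
have [m [m0 md me]] := exists_min_gt0 d0 e2.
have [b1 [f1 [Gb1 bm]]] := G_dense b m0.
have bd := lt_le_trans bm md; have be := lt_le_trans bm me.
have : ball c (e / 2) f1 by apply: dc; exists b1.
rewrite -ball_normE /= => cf1.
rewrite (le_trans (ler_distD f1 _ _))// [leLHS]addrC (splitr e) addrA.
apply: lerD; last exact: ltW.
rewrite (le_trans (G_dist Gb1 Gb'))// (le_trans (ler_distD b _ _))//.
by rewrite [leLHS]addrC lerD2l distrC ltW.
Qed.

(** The pointwise limits form a 1-Lipschitz map that agrees with the graph. Each algebraic identity
    holds on the graph and spreads by continuity and density, one variable at a time. *)
Lemma star_hom_extension : exists f : B -> F,
  [/\ star_hom f, forall b, `|f b| <= `|b| & forall b c, G b c -> f b = c].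
Proof.
have [f fP] := choice ext_exists.
have f_lip b b' : `|f b - f b'| <= `|b - b'|.
  apply/ler_addgt0Pr => e /= e0; have e2 : 0 < e / 2 by rewrite divr_gt0.
  have [b1 [f1 [Gb1 bb1]]] := G_dense b e2.
  rewrite (le_trans (ler_distD f1 _ _))// [leRHS]addrC (splitr e) -addrA.
  apply: lerD; first exact: le_trans (fP _ _ _ Gb1) (ltW bb1).
  rewrite distrC (le_trans (fP _ _ _ Gb1))// (le_trans (ler_distD b _ _))//.
  by rewrite [leLHS]addrC; apply: lerD; [exact: ltW|rewrite distrC].
have f_cont : continuous f.
  by apply: (@lip_continuous _ _ _ _ 1) => // x y; rewrite mul1r.
have fG b c : G b c -> f b = c.
  move=> Gb; apply/subr0_eq/eqP; rewrite -normr_le0.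
  by rewrite (le_trans (fP _ _ _ Gb))// subrr normr0.
have dense_ind (h : B -> F) : continuous h ->
    (forall b c, G b c -> h b = 0) -> forall b, h b = 0.
  move=> hc h0 b; apply: (@closed_approx _ _ [set b | h b = 0]).
    exact: closed_preimage_eq0.
  move=> e /(G_dense b)[b' [f' [Gb' bb']]]; exists b' => //=.
  exact: h0 Gb'.
exists f; split=> //; last first.
  move=> b; apply/ler_addgt0Pr => e /= e0.
  have e2 : 0 < e / 2 by rewrite divr_gt0.
  have [b1 [f1 [Gb1 bb1]]] := G_dense b e2.
  rewrite -(subrK f1 (f b)) (le_trans (ler_normD _ _))//.
  rewrite [leLHS]addrC (splitr e) addrA; apply: lerD; last first.
    exact: le_trans (fP _ _ _ Gb1) (ltW bb1).
  rewrite (le_trans (G_le Gb1))// -[in leLHS](subrK b b1) [X in `|X|]addrC.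
  rewrite (le_trans (ler_normD _ _))// lerD2l distrC.
  exact: ltW.
split=> [k b b'|b b'|b]; apply/subr0_eq.
- apply: (dense_ind (fun b => f (k *: b + b') - (k *: f b + f b'))).
    move=> x; apply: cvgB.
      apply: continuous_comp; last exact: f_cont.
      by apply: cvgD; [exact: scaler_continuous|exact: cvg_cst].
    apply: cvgD; [|exact: cvg_cst].
    by apply: cvgZl_tmp; exact: f_cont.
  move=> {}b c Gb.
  apply: (dense_ind (fun b' => f (k *: b + b') - (k *: f b + f b'))).
    move=> x; apply: cvgB.
      apply: continuous_comp; last exact: f_cont.
      by apply: cvgD; [exact: cvg_cst|exact: cvg_id].
    by apply: cvgD; [exact: cvg_cst|exact: f_cont].
  move=> {}b' c' Gb'; rewrite (fG _ _ Gb) (fG _ _ Gb').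
  by rewrite (fG _ _ (GZD k Gb Gb')) subrr.
- apply: (dense_ind (fun b => f (b ** b') - f b ** f b')).
    move=> x; apply: cvgB.
      by apply: continuous_comp; [exact: smulr_continuous|exact: f_cont].
    by apply: (@continuous_comp _ _ _ f (fun y => y ** f b'));
      [exact: f_cont|exact: smulr_continuous].
  move=> {}b c Gb.
  apply: (dense_ind (fun b' => f (b ** b') - f b ** f b')).
    move=> x; apply: cvgB.
      by apply: continuous_comp; [exact: smull_continuous|exact: f_cont].
    by apply: (@continuous_comp _ _ _ f (smul (f b)));
      [exact: f_cont|exact: smull_continuous].
  move=> {}b' c' Gb'; rewrite (fG _ _ Gb) (fG _ _ Gb').
  by rewrite (fG _ _ (GM Gb Gb')) subrr.
- apply: (dense_ind (fun b => f (star b) - star (f b))).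
    move=> x; apply: cvgB.
      by apply: continuous_comp; [exact: star_continuous|exact: f_cont].
    by apply: (@continuous_comp _ _ _ f star);
      [exact: f_cont|exact: star_continuous].
  by move=> {}b c Gb; rewrite (fG _ _ Gb) (fG _ _ (GS Gb)) subrr.
Qed.

End extension.

(* Stands in for a complete-space instance, which bprod and substar_type
   lack. *)
Definition majorized_complete (R : realType) (V : normedModType R[i]) : Prop :=
  forall (u : nat -> V) (s : nat -> R),
    (forall m, `|u m.+1 - u m| <= (s m.+1 - s m)%:C%C) -> cvgn s ->
    exists l, forall m, `|l - u m| <= (limn s - s m)%:C%C.

(** Limits are taken coordinatewise; as the tail bound is the same at every coordinate, it is a
    bound in the supremum norm. *)
Lemma bprod_majorized_complete (R : realType) (I : Type)
    (E : I -> cstarAlgType R) :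
  majorized_complete (bprod (fun i => E i : starAlgType R)).
Proof.
move=> u s us cs.
have lP i : exists l, forall m, `|l - u m i| <= (limn s - s m)%:C%C.
  apply: (@cvg_majorized _ _ (fun m => u m i)) => // m.
  exact: le_trans (bprod_norm_ub (u m.+1 - u m) i) (us m).
pose l i := sval (cid (lP i)).
have ul i m : `|l i - u m i| <= (limn s - s m)%:C%C.
  by rewrite /l; case: cid => l' /= ->.
have l_bounded : exists M : R[i], forall i, `|l i| <= M.
  exists ((limn s - s 0)%:C%C + `|u 0|) => i.
  rewrite -(subrK (u 0 i) (l i)) (le_trans (ler_normD _ _))// lerD//.
  exact: bprod_norm_ub.
exists (BProd l_bounded) => m; apply: bprod_norm_le => [|i]; last exact: ul.
rewrite lecR subr_ge0 nondecreasing_cvgn_le//.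
apply: homo_leq => [x|y x z|k]; [exact: lexx|exact: le_trans|].
by rewrite -subr_ge0 -lecR (le_trans (normr_ge0 _) (us k)).
Qed.

Lemma substar_majorized_complete (R : realType) (E : starAlgType R)
    (S : substar E) :
  majorized_complete E -> majorized_complete (substar_type S).
Proof.
move=> Ec u s us cs.
have usv m : `|subval (u m.+1) - subval (u m)| <= (s m.+1 - s m)%:C%C.
  by apply: le_trans (us m); rewrite -scaleN1r -subvalZ -subvalD scaleN1r.
have [l lP] := Ec (fun m => subval (u m)) s usv cs.
have [Scl _ _ _ _] := substarP S.
have Sl : substar_set S l.
  apply: closed_approx => // e e0; have eE := ge0_ReE (ltW e0).
  have e0' : 0 < complex.Re e by rewrite -ltcR -eE.
  have /cvgrPdist_lt /(_ _ e0') [N _ /(_ N (leqnn N))/= sN] := cs.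
  exists (subval (u N)); first exact: subval_in.
  by rewrite (le_lt_trans (lP N))// eE ltcR (le_lt_trans (ler_norm _)).
exists (subelt Sl) => m; apply: le_trans (lP m).
by rewrite -[in leRHS]scaleN1r -subvalZ -[l]/(subval (subelt Sl)) -subvalD scaleN1r.
Qed.

(* The series argument of the open mapping theorem. *)
Lemma surjective_of_dense_lifts (R : realType) (B F : starAlgType R)
    (f : B -> F) :
  majorized_complete B -> star_hom f -> (forall b, `|f b| <= `|b|) ->
  (forall c (e : R[i]), 0 < e ->
    exists b, `|c - f b| < e /\ `|b| <= 2 * `|f b|) ->
  forall c, exists b, f b = c.
Proof.
move=> Bc hf f_le lifts c0.
(* With an error of at most |c| / 2, [|f b|] is at most 2|c|, and the lift bound doubles this to
   4|c|. *)
have step c : exists b, `|c - f b| <= 2^-1 * `|c| /\ `|b| <= 4 * `|c|.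
  have [->|c_neq0] := eqVneq c 0.
    by exists 0; rewrite (star_hom0 hf) subrr !normr0 !mulr0.
  have e0 : 0 < 2^-1 * `|c| by rewrite mulr_gt0 ?normr_gt0// invr_gt0.
  have [b [cb b2]] := lifts c _ e0; exists b; split; first exact: ltW.
  rewrite (le_trans b2)// (_ : 4 = 2 * 2); last by rewrite -natrM.
  rewrite -mulrA ler_pM2l// -(subrK c (f b)) (le_trans (ler_normD _ _))//.
  rewrite mulr_natl mulr2n lerD2r distrC (le_trans (ltW cb))// ler_piMl//.
  by rewrite invf_le1// ler1n.
have [L LP] := choice step.
pose r k := iter k (fun c => c - f (L c)) c0.
pose C := complex.Re `|c0|.
have CE : `|c0| = C%:C%C := ge0_ReE (normr_ge0 _).
have C0 : 0 <= C by rewrite -lecR -CE; exact: normr_ge0.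
pose g k : R := C * 2^-1 ^+ k.
have halfC : (2^-1 : R[i]) = (2^-1)%:C%C by rewrite fmorphV rmorphMn rmorph1.
have r_le k : `|r k| <= (g k)%:C%C.
  elim: k => [|k ih]; first by rewrite /g expr0 mulr1 -CE.
  rewrite (le_trans (LP (r k)).1)// /g exprS mulrCA rmorphM halfC.
  by rewrite ler_wpM2l// lecR invr_ge0.
pose u k := \sum_(i < k) L (r i).
have fu k : f (u k) = c0 - r k.
  elim: k => [|k ih]; first by rewrite /u big_ord0 (star_hom0 hf) subrr.
  rewrite /u big_ord_recr /= (star_homD hf) -/(u k) ih.
  by rewrite opprB addrA addrAC.
(* The k-th partial sum of the series with terms [4 * g i], in closed form. *)
pose s k := 8 * (C - g k).
have us k : `|u k.+1 - u k| <= (s k.+1 - s k)%:C%C.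
  rewrite /u big_ord_recr /= [X in `|X|]addrC addKr (le_trans (LP (r k)).2)//.
  have -> : s k.+1 - s k = 4 * g k by rewrite /s /g exprS; field.
  by rewrite rmorphM rmorphMn rmorph1 ler_pM2l// r_le.
have g_cvg : g k @[k --> \oo] --> (0 : R).
  rewrite -(mulr0 C); apply: cvgMr; apply: cvg_expr.
  by rewrite ger0_norm ?invr_ge0// invf_lt1// ltr1n.
have s_cvg : s k @[k --> \oo] --> 8 * C.
  apply: cvgMr; rewrite -[X in _ --> X]subr0; apply: cvgB => //.
  exact: cvg_cst.
have [b bP] := Bc u s us (cvgP _ s_cvg).
exists b; apply/subr0_eq/eqP; rewrite -normr_le0.
apply/ler_addgt0Pr => e /= e0; rewrite add0r; have eE := ge0_ReE (ltW e0).
(* The tail of [s] contributes [8 * g N] and the remainder [r N] one more [g N]. *)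
have e9 : 0 < complex.Re e / 9 by rewrite divr_gt0// -ltcR -eE.
have /cvgrPdist_lt /(_ _ e9) [N _ /(_ N (leqnn N))/= gN] := g_cvg.
rewrite (le_trans (ler_distD (f (u N)) _ _))// -(star_homB hf).
have -> : f (u N) - c0 = - r N by rewrite fu addrC addKr.
rewrite normrN (le_trans (lerD (le_trans (f_le _) (bP N)) (r_le N)))//.
rewrite eE -rmorphD lecR (cvg_lim _ s_cvg)//.
move: gN; rewrite sub0r normrN => /(le_lt_trans (ler_norm _)) gN.
have -> : 8 * C - s N + g N = 9 * g N by rewrite /s; ring.
by rewrite mulrC -ler_pdivlMr// ltW.
Qed.

(** * c_0-sums and the lattice *)

Section c0_sums.
Variables (R : realType) (I : choiceType) (E : I -> starAlgType R).
Implicit Types f g : c0_sum E.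

Definition c0_at f (i : I) : E i := (subval f : bprod E) i.

Lemma c0P f g : (forall i, c0_at f i = c0_at g i) -> f = g.
Proof. by move=> fg; apply/val_inj/bprodP. Qed.

Lemma c0_atZD c f g i : c0_at (c *: f + g) i = c *: c0_at f i + c0_at g i.
Proof. by rewrite /c0_at subvalD subvalZ. Qed.

Lemma c0_atD f g i : c0_at (f + g) i = c0_at f i + c0_at g i.
Proof. by rewrite /c0_at subvalD. Qed.

Lemma c0_at0 i : c0_at 0 i = 0.
Proof. by rewrite /c0_at subval0. Qed.

Lemma c0_atM f g i : c0_at (f ** g) i = c0_at f i ** c0_at g i.
Proof. by []. Qed.

Lemma c0_atS f i : c0_at (star f) i = star (c0_at f i).
Proof. by []. Qed.

Lemma c0_at_le f i : `|c0_at f i| <= `|f|.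
Proof. exact: bprod_norm_ub. Qed.

Lemma c0_norm_le f (M : R[i]) : 0 <= M -> (forall i, `|c0_at f i| <= M) ->
  `|f| <= M.
Proof. exact: bprod_norm_le. Qed.

Lemma c0_at_finite f (e : R[i]) : 0 < e -> finite_set [set i | e <= `|c0_at f i|].
Proof. exact: (subval_in f). Qed.

Lemma c0_single_same i (u : E i) : c0_at (c0_single u) i = u.
Proof. exact: dfwithin. Qed.

Lemma c0_single_other i (u : E i) k : i != k -> c0_at (c0_single u) k = 0.
Proof. by move=> ik; apply: dfwithout. Qed.

Lemma norm_c0_single i (u : E i) : `|c0_single u| = `|u|.
Proof.
apply/eqP; rewrite eq_le; apply/andP; split.
  apply: c0_norm_le => // k; have [<-|ik] := eqVneq i k.
    by rewrite c0_single_same.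
  by rewrite c0_single_other// normr0.
by rewrite -[in leLHS](c0_single_same u) c0_at_le.
Qed.

Lemma c0_single_hom i : star_hom (@c0_single _ _ E i).
Proof.
split=> [c u v|u v|u]; apply: c0P => k; rewrite ?c0_atZD ?c0_atM ?c0_atS;
  have [<-|ik] := eqVneq i k; rewrite ?c0_single_same// !c0_single_other//.
- by rewrite scaler0 addr0.
- by rewrite smul0l.
- by rewrite star0.
Qed.

(** Keeping the finitely many coordinates of norm at least e/2 changes [f] by at most e/2, so finite
    sums of single coordinates are dense. *)
Lemma c0_sum_ind (P : set (c0_sum E)) : closed P -> P 0 ->
  (forall f g, P f -> P g -> P (f + g)) ->
  (forall i u, P (@c0_single _ _ E i u)) -> forall f, P f.
Proof.
move=> Pcl P0 PD Ps f; apply: closed_approx => // e e0.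
have e2 : 0 < e / 2 by rewrite divr_gt0.
pose D := fset_set [set i | e / 2 <= `|c0_at f i|].
pose g : c0_sum E := \sum_(i <- finmap.enum_fset D) c0_single (c0_at f i).
exists g; first by apply: big_ind.
have at_g k : c0_at g k = if k \in D then c0_at f k else 0.
  rewrite /g (big_morph (c0_at^~ k) (fun f g => c0_atD f g k) (c0_at0 k)).
  case: ifP => kD.
    rewrite (bigD1_seq k)//= c0_single_same big1 ?addr0// => i ik.
    by rewrite c0_single_other.
  rewrite big_seq big1// => i iD; rewrite c0_single_other//.
  by apply: contraFneq kD => <-.
apply: (@le_lt_trans _ _ (e / 2)); last by rewrite ltr_pdivrMr// ltr_pMr// ltr1n.
apply: c0_norm_le => [|k]; first exact: ltW.
rewrite -scaleN1r addrC c0_atZD scaleN1r addrC at_g in_fset_set; last first.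
  exact: c0_at_finite.
case: ifPn => [_|]; first by rewrite subrr normr0 ltW.
rewrite notin_setE /= => /negP; rewrite subr0.
by rewrite -(real_ltNge (normr_real _) (gtr0_real e2)) => /ltW.
Qed.

End c0_sums.

(** * Positive and negative parts in the lattice *)

Section lattice.
Variable n : nat.
Implicit Types (h : zlat n) (x y z : zplus n).

Definition pos_part h : zplus n := [ffun i => if 0 <= h i then `|h i|%N else 0%N].
Definition neg_part h : zplus n := [ffun i => if 0 <= h i then 0%N else `|h i|%N].
(** The subtraction is truncated: [y] with [y i = 0] stays fixed, which makes [neg_part_succ] hold
    without a case distinction. *)
Definition lat_pred (i : 'I_n) y : zplus n := [ffun k => (y k - (k == i))%N].

Lemma lat_ofD x y : lat_of (x + y) = lat_of x + lat_of y.
Proof. by apply/ffunP => i; rewrite !ffunE PoszD. Qed.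

Lemma lat_of0 : lat_of (0 : zplus n) = 0.
Proof. by apply/ffunP => i; rewrite !ffunE. Qed.

Lemma pos_neg_part h : lat_of (pos_part h) - lat_of (neg_part h) = h.
Proof. by apply/ffunP => i; rewrite !ffunE; move: (h i) => z; case: ifP; lia. Qed.

Lemma pos_part_opp y : pos_part (- lat_of y) = 0.
Proof. by apply/ffunP => i; rewrite !ffunE; move: (y i) => z; case: ifP; lia. Qed.

Lemma neg_part_opp y : neg_part (- lat_of y) = y.
Proof. by apply/ffunP => i; rewrite !ffunE; move: (y i) => z; case: ifP; lia. Qed.

Lemma nonneg_neg_part h : nonneg h = (neg_part h == 0).
Proof.
apply/forallP/eqP => [h0|h0 i].
  by apply/ffunP => i; rewrite !ffunE h0.
by move/ffunP/(_ i) : h0; rewrite !ffunE; move: (h i) => z; case: ifP => //; lia.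
Qed.

Lemma nonneg_pos_part h : nonneg h -> pos_part h = abs_lat h.
Proof. by move/forallP => h0; apply/ffunP => i; rewrite !ffunE h0. Qed.

Lemma pos_part_succ i h : pos_part (h + lat_of (generator i)) =
  if neg_part h i == 0%N then pos_part h + generator i else pos_part h.
Proof.
rewrite ffunE; case: ifPn => hi; apply/ffunP => k; move: hi;
  rewrite !ffunE; have [->|ki] := eqVneq k i.
- by move: (h i) => z; case: ifP; case: ifP; lia.
- by rewrite /= ?addr0 ?addn0.
- by move: (h i) => z; case: ifP; case: ifP; lia.
- by rewrite /= ?addr0 ?addn0.
Qed.

Lemma neg_part_succ i h :
  neg_part (h + lat_of (generator i)) = lat_pred i (neg_part h).
Proof.
apply/ffunP => k; rewrite !ffunE; have [->|ki] := eqVneq k i.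
- by move: (h i) => z; case: ifP; case: ifP; lia.
- by move: (h k) => z; case: ifP; case: ifP; lia.
Qed.

Lemma lat_predK i y : lat_pred i (y + generator i) = y.
Proof. by apply/ffunP => k; rewrite !ffunE addnK. Qed.

Lemma lat_pred_succ i y : y i != 0%N -> lat_pred i y + generator i = y.
Proof.
move=> yi; apply/ffunP => k; rewrite !ffunE; have [->|ki] := eqVneq k i.
  by move: (y i) yi => z; lia.
by move: (y k) => z; lia.
Qed.

Lemma lat_pred_id i y : y i = 0%N -> lat_pred i y = y.
Proof.
move=> yi; apply/ffunP => k; rewrite !ffunE; have [->|ki] := eqVneq k i.
  by rewrite yi.
by rewrite subn0.
Qed.

Lemma lat_succ_at i y : (y + generator i) i = (y i).+1.
Proof. by rewrite !ffunE eqxx; exact: addn1. Qed.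

(** Induction on the sum of the coordinates. *)
Lemma zplus_ind (P : zplus n -> Prop) :
  P 0 -> (forall i x, P x -> P (x + generator i)) -> forall x, P x.
Proof.
move=> P0 PS x; have [m] := ubnP (\sum_i x i); elim: m x => // m ih x xm.
have [i xi|x0] := pickP (fun i => x i != 0%N); last first.
  suff -> : x = 0 by [].
  by apply/ffunP => i; rewrite ffunE; apply/eqP/negPn; rewrite x0.
rewrite -(lat_pred_succ xi); apply/PS/ih; rewrite -ltnS (leq_trans _ xm)// ltnS.
rewrite (bigD1 i)//= [leqRHS](bigD1 i)//= ffunE eqxx -addSn leq_add//.
  by rewrite subn1 prednK// lt0n.
by apply: leq_sum => k _; rewrite ffunE leq_subr.
Qed.

Lemma perp_supp x y : perp x y <-> forall i, i \in supp y -> x i = 0%N.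
Proof.
split=> [xy i|xy].
  by rewrite inE; move/ffunP/(_ i) : xy; rewrite !ffunE; lia.
apply/ffunP => i; rewrite !ffunE; have := xy i; rewrite inE.
by case: (posnP (y i)) => [->|yi /(_ isT) ->]; rewrite ?minn0 ?min0n.
Qed.

Lemma perp_generator i x : perp (generator i) x <-> x i = 0%N.
Proof.
rewrite perp_supp; split=> [/(_ i)|xi k].
  by rewrite inE ffunE eqxx; case: (posnP (x i)) => // _ /(_ isT).
by rewrite inE ffunE; case: eqP => // ->; rewrite xi.
Qed.

End lattice.

(** * The product dilation and its quotient *)

Lemma closure_min (T : topologicalType) (D S : set T) :
  closed S -> D `<=` S -> closure D `<=` S.
Proof.
move=> Scl DS; rewrite [X in _ `<=` X]((closure_id S).1 Scl).
exact: closure_subset.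
Qed.

(** For the binary operations, first the second and then the first argument is moved from [D] to its
    closure, by separate continuity. *)
Lemma closure_substar (R : realType) (E : starAlgType R) (D : set E) :
  D 0 -> (forall c x y, D x -> D y -> D (c *: x + y)) ->
  (forall x y, D x -> D y -> D (x ** y)) -> (forall x, D x -> D (star x)) ->
  is_substar (closure D).
Proof.
move=> D0 DZD DM DS; split.
- exact: closed_closure.
- exact: subset_closure.
- move=> c x y Dx; move: y; apply: closure_min => [|y Dy].
    apply: (@preimage_closed _ _ (fun y => c *: x + y)); last exact: closed_closure.
    by move=> y _; apply: cvgD; [exact: cvg_cst|exact: cvg_id].
  move: x Dx; apply: closure_min => [|x Dx]; last exact/subset_closure/DZD.
  apply: (@preimage_closed _ _ (fun x => c *: x + y)); last exact: closed_closure.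
  by move=> x _; apply: cvgD; [exact: scaler_continuous|exact: cvg_cst].
- move=> x y Dx; move: y; apply: closure_min => [|y Dy].
    apply: (@preimage_closed _ _ (smul x)); last exact: closed_closure.
    by move=> y _; exact: smull_continuous.
  move: x Dx; apply: closure_min => [|x Dx]; last exact/subset_closure/DM.
  apply: (@preimage_closed _ _ (fun x => x ** y)); last exact: closed_closure.
  by move=> x _; exact: smulr_continuous.
- apply: closure_min => [|x Dx]; last exact/subset_closure/DS.
  apply: (@preimage_closed _ _ star); last exact: closed_closure.
  by move=> x _; exact: star_continuous.
Qed.

(** The quotient norm is an infimum, so for nonzero [u] any factor above 1 leaves room for a lift; 0
    lifts to 0. *)
Lemma exists_quot_lift (R : realType) (E : starAlgType R) (J : sideal E)
    (u : quot_alg J) : exists a, quot_map J a = u /\ `|a| <= 2 * `|u|.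
Proof.
have [->|u0] := eqVneq u 0.
  by exists 0; rewrite quot_map0 !normr0 mulr0.
apply: contrapT => noa; have : 2 * `|u| <= 1 * `|u|.
  apply: quot_norm_ge => [|//|a au]; first by rewrite ger0_real// mulr_ge0.
  rewrite mul1r real_leNgt ?normr_real ?ger0_real ?mulr_ge0//.
  by apply/negP => /ltW au'; apply: noa; exists a.
by rewrite ler_pM2r ?normr_gt0// lern1.
Qed.

Section product_dilation.
Variables (R : realType) (A : cstarAlgType R) (n : nat).
Variable alpha : unital_dynsys A n.
Local Notation c0A := (c0_sum (fun _ : zplus n => A : starAlgType R)).
Local Notation single y a :=
  (@c0_single _ _ (fun _ : zplus n => A : starAlgType R) y a).
Implicit Types (f g : c0A) (a : A) (x y z : zplus n) (h : zlat n).

Let ahom x : star_hom (alpha x) := dyn_act_hom alpha x.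
Let alpha0 a : alpha 0 a = a.
Proof. by case: (dyn_actP alpha). Qed.
Let alphaD x y a : alpha (x + y) a = alpha x (alpha y a).
Proof. by case: (dyn_actP alpha). Qed.

Fact orbit_bounded f : exists M : R[i], forall h : zlat n,
  `|alpha (pos_part h) (c0_at f (neg_part h))| <= M.
Proof.
by exists `|f| => h; rewrite (le_trans (dyn_act_norm _ _ _))// c0_at_le.
Qed.

(* The image of these tuples is the part C^*(beta_x iota(A) : x >= 0) of B;
   the coordinates at -y, y >= 0, are free, and the others are determined by
   alpha. *)
Definition orbit_tuple f : bprod (fun _ : zlat n => A : starAlgType R) :=
  BProd (orbit_bounded f).

Lemma orbit_tuple_hom : star_hom orbit_tuple.
Proof.
split=> [c f g|f g|f]; apply: bprodP => h /=.
- by rewrite c0_atZD (star_homZD (ahom _)).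
- by rewrite c0_atM (star_homM (ahom _)).
- by rewrite c0_atS (star_homS (ahom _)).
Qed.

(** The coordinates at -y return [f] itself; all others are images under contractions. *)
Lemma norm_orbit_tuple f : `|orbit_tuple f| = `|f|.
Proof.
apply/eqP; rewrite eq_le; apply/andP; split.
  apply: bprod_norm_le => // h.
  by rewrite (le_trans (dyn_act_norm _ _ _))// c0_at_le.
apply: c0_norm_le => // y.
have := bprod_norm_ub (orbit_tuple f) (- lat_of y).
by rewrite /= pos_part_opp neg_part_opp alpha0.
Qed.

Lemma orbit_tuple_continuous : continuous orbit_tuple.
Proof.
apply: (@lip_continuous _ _ _ _ 1) => // f g.
by rewrite mul1r -(star_homB orbit_tuple_hom) norm_orbit_tuple.
Qed.

Lemma orbit_tuple_iota a : orbit_tuple (single 0 a) = prod_iota alpha a.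
Proof.
apply: bprodP => h /=; rewrite nonneg_neg_part; have [h0|h0] := eqVneq.
  by rewrite h0 c0_single_same nonneg_pos_part// nonneg_neg_part h0.
by rewrite c0_single_other 1?eq_sym// (star_hom0 (ahom _)).
Qed.

(** The coordinate at -y of the shifted tuple: i - y has positive part i and negative part y if y_i
    = 0, and equals -(y - i) otherwise. *)
Definition step_fun (i : 'I_n) f y : A :=
  if y i == 0%N then alpha (generator i) (c0_at f y) else c0_at f (lat_pred i y).

Fact step_bounded i f : exists M : R[i], forall y, `|step_fun i f y| <= M.
Proof.
exists `|f| => y; rewrite /step_fun; case: ifP => _; last exact: c0_at_le.
by rewrite (le_trans (dyn_act_norm _ _ _))// c0_at_le.
Qed.

Fact step_c0 i f :
  c0_set (BProd (step_bounded i f : exists M : R[i], forall y,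
    `|step_fun i f y : (A : starAlgType R)| <= M)).
Proof.
move=> e e0; have fe := c0_at_finite f e0.
apply: (sub_finite_set _ (_ : finite_set ([set y | e <= `|c0_at f y|] `|`
  (fun y => y + generator i) @` [set y | e <= `|c0_at f y|]))).
  move=> y /=; rewrite /step_fun; case: ifPn => yi ey; [left|right].
    exact: le_trans ey (dyn_act_norm _ _ _).
  by exists (lat_pred i y) => //; exact: lat_pred_succ.
by rewrite finite_setU; split=> //; exact: finite_image.
Qed.

Definition step (i : 'I_n) f : c0A :=
  subelt (step_c0 i f : substar_set (SubStar _) _).

Lemma step_orbit i f : prod_shift (lat_of (generator i)) (orbit_tuple f) =
  orbit_tuple (step i f).
Proof.
apply: bprodP => h /=; rewrite pos_part_succ neg_part_succ /c0_at /= /step_fun.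
case: ifP => hi; first by rewrite alphaD lat_pred_id//; exact/eqP.
by [].
Qed.

(** This is the formula for gamma_i before division by the ideals Q_x. If y_i = 0, both coordinates
    y and y + i of the result read the entry at y. *)
Lemma step_single i y a : step i (single y a) =
  if y i == 0%N then single y (alpha (generator i) a) + single (y + generator i) a
  else single (y + generator i) a.
Proof.
have neq : y != y + generator i.
  by apply/eqP => /ffunP/(_ i)/esym/eqP; rewrite lat_succ_at gtn_eqF.
have other_pred (w : zplus n) : w i != 0%N -> w != y + generator i ->
    y != lat_pred i w.
  by move=> wi; apply: contraNneq => ->; rewrite lat_pred_succ.
apply: c0P => w; rewrite {1}/c0_at /= /step_fun.
have -> : c0_at (if y i == 0%N then single y (alpha (generator i) a) +
    single (y + generator i) a else single (y + generator i) a) w =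
    (if (y i == 0%N) && (w == y) then alpha (generator i) a else 0) +
    (if w == y + generator i then a else 0).
  have sE v b : c0_at (single v b) w = if w == v then b else 0.
    have [->|wv] := eqVneq w v; first by rewrite c0_single_same.
    by rewrite c0_single_other// eq_sym.
  by case: (y i == 0%N); rewrite ?c0_atD !sE//= add0r.
have [wi|wi] := eqVneq (w i) 0%N.
  have /negPf -> : w != y + generator i.
    by apply: contra_eqN wi => /eqP ->; rewrite lat_succ_at.
  rewrite addr0; have [wy|wy] := eqVneq w y.
    by rewrite -wy wi eqxx c0_single_same.
  by rewrite andbF c0_single_other 1?eq_sym// (star_hom0 (ahom _)).
have -> : (y i == 0%N) && (w == y) = false.
  by apply/andP => -[/eqP yi /eqP wy]; rewrite wy yi in wi.
rewrite add0r; have [->|wy] := eqVneq; first by rewrite lat_predK c0_single_same.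
by rewrite c0_single_other// other_pred.
Qed.

Lemma step_hom i : star_hom (step i).
Proof.
split=> [c f g|f g|f]; apply: c0P => y; rewrite ?c0_atZD ?c0_atM ?c0_atS;
  rewrite /c0_at /= /step_fun; case: ifP => _ //; rewrite ?c0_atZD//.
- by rewrite (star_homZD (ahom _)).
- by rewrite c0_atM (star_homM (ahom _)).
- by rewrite c0_atS (star_homS (ahom _)).
Qed.

Lemma norm_step i f : `|step i f| <= `|f|.
Proof.
apply: c0_norm_le => // y; rewrite /c0_at /= /step_fun; case: ifP => _.
  by rewrite (le_trans (dyn_act_norm _ _ _))// c0_at_le.
exact: c0_at_le.
Qed.

(** Induction on [y]: a shift by a generator produces the next single coordinate, up to a summand at
    [y] that is already in the algebra. *)
Fact orbit_single_in y a :
  gen_substar (dil_gen alpha) (orbit_tuple (single y a)).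
Proof.
have [_ _ gD _ _] := gen_substarP (dil_gen alpha).
elim/zplus_ind: y a => [|i y ih] a.
  by rewrite orbit_tuple_iota; exact: dil_iota_in.
have := dil_shift_in (lat_of (generator i)) (ih a).
rewrite step_orbit step_single; case: ifP => // _.
rewrite (star_homD orbit_tuple_hom) => in_sum.
rewrite -(addKr (orbit_tuple (single y (alpha (generator i) a))) (orbit_tuple _)).
by rewrite -scaleN1r; exact: gD.
Qed.

Fact orbit_in f : gen_substar (dil_gen alpha) (orbit_tuple f).
Proof.
have [gcl g0 gD _ _] := gen_substarP (dil_gen alpha).
move: f.
apply: (c0_sum_ind (P := orbit_tuple @^-1` gen_substar (dil_gen alpha)))
  => [||f g Pf Pg|y a].
- by apply: preimage_closed => // x _; exact: orbit_tuple_continuous.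
- by rewrite /preimage /= (star_hom0 orbit_tuple_hom).
- rewrite /preimage /= (star_homD orbit_tuple_hom) -[X in X + _]scale1r.
  exact: gD.
- exact: orbit_single_in.
Qed.

Definition dil_orbit f : dil_alg alpha :=
  @subelt _ _ (SubStar (gen_substarP (dil_gen alpha))) _ (orbit_in f).

Lemma dil_orbit_hom : star_hom dil_orbit.
Proof.
split=> [c f g|f g|f]; apply/val_inj.
- exact: (star_homZD orbit_tuple_hom).
- by rewrite /= (star_homM orbit_tuple_hom).
- by rewrite /= (star_homS orbit_tuple_hom).
Qed.

Lemma norm_dil_orbit f : `|dil_orbit f| = `|f|.
Proof. exact: norm_orbit_tuple. Qed.

Lemma dil_orbit_step i f : dil_shift (lat_of (generator i)) (dil_orbit f) =
  dil_orbit (step i f).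
Proof. by apply/val_inj; rewrite /= step_orbit. Qed.

Lemma dil_orbit_iota a : dil_orbit (single 0 a) = dil_iota alpha a.
Proof. by apply/val_inj; rewrite /= orbit_tuple_iota. Qed.

Lemma dil_shift_hom h : star_hom (@dil_shift _ _ _ alpha h).
Proof.
split=> [c b b'|b b'|b]; apply/val_inj.
- exact: (star_homZD (prod_shift_hom A h) c (subval b) (subval b')).
- exact: (star_homM (prod_shift_hom A h) (subval b) (subval b')).
- exact: (star_homS (prod_shift_hom A h) (subval b)).
Qed.

Lemma dil_shiftD h k (b : dil_alg alpha) :
  dil_shift (h + k) b = dil_shift h (dil_shift k b).
Proof. by apply/val_inj/bprodP => l /=; rewrite addrA. Qed.

Lemma dil_shift0 (b : dil_alg alpha) : dil_shift 0 b = b.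
Proof. by apply/val_inj/bprodP => l /=; rewrite addr0. Qed.

Lemma norm_dil_shift h (b : dil_alg alpha) : `|dil_shift h b| = `|b|.
Proof.
have shift_le k (b' : dil_alg alpha) : `|dil_shift k b'| <= `|b'|.
  by apply: bprod_norm_le => // l; exact: (bprod_norm_ub (subval b' : bprod _)).
apply/eqP; rewrite eq_le shift_le /=.
by rewrite -{1}(dil_shift0 b) -(addNr h) dil_shiftD shift_le.
Qed.

Fact dfk_map_bounded f : exists M : R[i], forall y,
  `|quot_map (dfk_Q_sideal alpha y) (c0_at f y)| <= M.
Proof.
by exists `|f| => y; rewrite (le_trans (quot_norm_le _ _))// c0_at_le.
Qed.

Fact dfk_map_c0 f : c0_set (BProd (dfk_map_bounded f)).
Proof.
move=> e e0; apply: sub_finite_set (c0_at_finite f e0) => y /= ey.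
exact: le_trans ey (quot_norm_le _ _).
Qed.

Definition dfk_map f : dfk_alg alpha :=
  subelt (dfk_map_c0 f : substar_set (SubStar (c0_substar _)) _).

Lemma dfk_map_at f y :
  c0_at (dfk_map f) y = quot_map (dfk_Q_sideal alpha y) (c0_at f y).
Proof. by []. Qed.

Lemma dfk_map_hom : star_hom dfk_map.
Proof.
have qhom y := quot_map_star_hom (dfk_Q_sideal alpha y).
split=> [c f g|f g|f]; apply: c0P => y.
- by rewrite c0_atZD !dfk_map_at c0_atZD (star_homZD (qhom y)).
- by rewrite c0_atM !dfk_map_at c0_atM (star_homM (qhom y)).
- by rewrite c0_atS !dfk_map_at c0_atS (star_homS (qhom y)).
Qed.

Lemma norm_dfk_map f : `|dfk_map f| <= `|f|.
Proof.
apply: c0_norm_le => // y; rewrite dfk_map_at (le_trans (quot_norm_le _ _))//.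
exact: c0_at_le.
Qed.

Lemma dfk_map_single y a : dfk_map (single y a) = dfk_elt alpha y a.
Proof.
apply: c0P => z; rewrite dfk_map_at; have [<-|yz] := eqVneq y z.
  by rewrite !c0_single_same.
by rewrite !c0_single_other// quot_map0.
Qed.

(** Coordinatewise lifts stay in c_0: where a lift has norm at least e, [c] has norm at least
    e/2. *)
Lemma dfk_map_lift (c : dfk_alg alpha) :
  exists f, dfk_map f = c /\ `|f| <= 2 * `|c|.
Proof.
have [a aP] := choice (fun y => exists_quot_lift (c0_at c y)).
have a_bounded : exists M : R[i], forall y, `|a y| <= M.
  exists (2 * `|c|) => y; rewrite (le_trans (aP y).2)// ler_wpM2l//.
  exact: (c0_at_le c y).
have a_c0 : c0_set (BProd a_bounded :
    bprod (fun _ : zplus n => A : starAlgType R)).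
  move=> e e0; have e2 : 0 < 2^-1 * e by rewrite mulr_gt0// invr_gt0.
  apply: sub_finite_set (c0_at_finite c e2) => y /= ey.
  by rewrite ler_pdivrMl// (le_trans ey)// (aP y).2.
exists (subelt (a_c0 : substar_set (SubStar (c0_substar _)) _)); split.
  by apply: c0P => y; rewrite dfk_map_at; exact: (aP y).1.
apply: c0_norm_le => [|y]; first by rewrite mulr_ge0.
rewrite (le_trans (aP y).2)// ler_wpM2l//.
exact: (c0_at_le c y).
Qed.

End product_dilation.

(** * Invariant boundary ideals at a single coordinate *)

Section boundary.
Variables (R : realType) (A : cstarAlgType R) (n : nat).
Variable alpha : unital_dynsys A n.
Local Notation c0A := (c0_sum (fun _ : zplus n => A : starAlgType R)).
Local Notation single y a :=
  (@c0_single _ _ (fun _ : zplus n => A : starAlgType R) y a).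
Implicit Types (f g : c0A) (a : A) (x y z : zplus n) (h : zlat n).

Let ahom x : star_hom (alpha x) := dyn_act_hom alpha x.
Let alphaD x y a : alpha (x + y) a = alpha x (alpha y a).
Proof. by case: (dyn_actP alpha). Qed.

(* If c is killed by alpha_i for all i in the support of y, then iota(c) is
   supported on the h >= 0 orthogonal to y. *)
Lemma shift_single_iota y z a c : perp z y ->
  (forall i, i \in supp y -> alpha (generator i) c = 0) ->
  dil_shift (lat_of z - lat_of y) (dil_orbit alpha (single y a)) **
    dil_iota alpha c = dil_iota alpha (alpha z a ** c).
Proof.
move=> /perp_supp zy c0; apply/val_inj/bprodP => h /=.
case: ifP => h0; last by rewrite smul0r.
have [i /andP[yi hi]|hy] :=
  pickP (fun i => (i \in supp y) && (abs_lat h i != 0%N)).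
  have -> : alpha (abs_lat h) c = 0.
    by rewrite -(lat_pred_succ hi) alphaD c0// (star_hom0 (ahom _)).
  rewrite smul0r -(lat_pred_succ hi) alphaD (star_homM (ahom _)) c0// smul0r.
  by rewrite (star_hom0 (ahom _)).
(* In the remaining case both [h] and [z] vanish on the support of [y], so h + z - y has negative
   part y and positive part h + z. *)
have coord i : [/\ 0 <= h i, (0 < y i)%N -> z i = 0%N & (0 < y i)%N -> h i = 0].
  split; first exact: (forallP h0).
  - by move=> yi; apply: zy; rewrite inE.
  - move=> yi; apply/eqP; rewrite -absz_eq0.
    by have := hy i; rewrite inE yi ffunE => /negbFE.
have -> : neg_part (h + (lat_of z - lat_of y)) = y.
  apply/ffunP => i; rewrite !ffunE; have := coord i.
  by move: (h i) (y i) (z i) => hi yi zi [hi0 yzi yhi]; case: ifP; lia.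
have -> : pos_part (h + (lat_of z - lat_of y)) = abs_lat h + z.
  apply/ffunP => i; rewrite !ffunE; have := coord i.
  by move: (h i) (y i) (z i) => hi yi zi [hi0 yzi yhi]; case: ifP; lia.
by rewrite c0_single_same alphaD (star_homM (ahom _)).
Qed.

(** Each pair [z], [c] in the definition of [dfk_Q] is tested by [shift_single_iota]: the product
    stays in [J], which meets the image of A only in 0, and iota is isometric. *)
Lemma boundary_single (J : set (dil_alg alpha)) y a :
  invariant_boundary_ideal J -> J (dil_orbit alpha (single y a)) ->
  dfk_Q alpha y a.
Proof.
move=> [[_ _ _ _ Jr] Ji Jb] Ja z zy c c0.
have Jac : J (dil_iota alpha (alpha z a ** c)).
  by rewrite -(shift_single_iota a zy c0); apply/Jr/Jb.
apply/eqP; rewrite -normr_le0.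
rewrite -(norm_c0_single (E := fun _ : zplus n => A) (i := 0)).
by rewrite -(norm_dil_orbit alpha) dil_orbit_iota (Ji _ Jac) normr0.
Qed.

End boundary.

(** * The isomorphism *)

Section automorphic_dilation.
Variables (R : realType) (A : cstarAlgType R) (n : nat).
Variables (alpha : unital_dynsys A n) (Ct : cstarAlgType R).
Variables (gamma : zplus n -> dfk_alg alpha -> dfk_alg alpha).
Variables (gammat : zlat n -> Ct -> Ct) (j : dfk_alg alpha -> Ct).
Hypothesis hgamma : dfk_action gamma.
Hypothesis hCt : minimal_automorphic_extension gamma gammat j.
Local Notation c0A := (c0_sum (fun _ : zplus n => A : starAlgType R)).
Local Notation single y a :=
  (@c0_single _ _ (fun _ : zplus n => A : starAlgType R) y a).
Local Notation orb := (dil_orbit alpha).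
Local Notation shift := (@dil_shift _ _ _ alpha).
Implicit Types (f g : c0A) (a : A) (x y z : zplus n) (h : zlat n).

Let j_hom : star_hom j. Proof. by case: hCt => _ []. Qed.
Let j_norm c : `|j c| = `|c|. Proof. by case: hCt => _ []. Qed.
Let gt_hom h : star_hom (gammat h). Proof. by case: hCt => -[]. Qed.
Let gt0 c : gammat 0 c = c. Proof. by case: hCt => -[]. Qed.
Let gtD h k c : gammat (h + k) c = gammat h (gammat k c).
Proof. by case: hCt => -[]. Qed.
(** Both [gammat h] and its inverse [gammat (- h)] are contractive. *)
Let gt_norm h c : `|gammat h c| = `|c|.
Proof.
apply/eqP; rewrite eq_le star_hom_contractive//=.
by rewrite -{1}(gt0 c) -(addNr h) gtD star_hom_contractive.
Qed.

Let jq f : Ct := j (dfk_map alpha f).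
Let jq_hom : star_hom jq.
Proof.
have qh := dfk_map_hom alpha; split=> [c f g|f g|f]; rewrite /jq.
- by rewrite (star_homZD qh) (star_homZD j_hom).
- by rewrite (star_homM qh) (star_homM j_hom).
- by rewrite (star_homS qh) (star_homS j_hom).
Qed.
Let jq_norm f : `|jq f| <= `|f|.
Proof. by rewrite /jq j_norm norm_dfk_map. Qed.

(** The difference of the two sides is additive and continuous in [f], so single coordinates
    suffice; there [step_single] matches the formula that determines gamma_i. *)
Let gt_step i f : gammat (lat_of (generator i)) (jq f) = jq (step alpha i f).
Proof.
have sh := step_hom alpha i; apply/subr0_eq; move: f.
pose d f := gammat (lat_of (generator i)) (jq f) - jq (step alpha i f).
have dD f g : d (f + g) = d f + d g.
  rewrite /d (star_homD jq_hom) (star_homD (gt_hom _)) (star_homD sh).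
  by rewrite (star_homD jq_hom) opprD addrACA.
have dN f g : d (f - g) = d f - d g.
  by apply/eqP; rewrite eq_sym subr_eq -dD subrK.
have d_cont : continuous d.
  apply: (@lip_continuous _ _ _ _ 2) => // f g; rewrite -dN.
  rewrite (le_trans (ler_normB _ _))// mulr_natl mulr2n lerD//.
    by rewrite gt_norm.
  by rewrite (le_trans (jq_norm _))// norm_step.
apply: (c0_sum_ind (P := [set f | d f = 0])) => /= [||f g df dg|y a].
- exact: closed_preimage_eq0.
- by apply: (@addrI _ (d 0)); rewrite -dD !addr0.
- by rewrite dD df dg addr0.
- rewrite /d /jq dfk_map_single; case: hCt => _ _ -> _.
  have [_ /(_ i y a)[gperp gsupp]] := hgamma.
  rewrite step_single; case: eqVneq => yi.
    rewrite gperp; last exact/perp_generator.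
    by rewrite (star_homD (dfk_map_hom alpha)) !dfk_map_single subrr.
  by rewrite gsupp ?inE ?lt0n// dfk_map_single subrr.
Qed.

(** Nonnegative shifts preserve the image of c_0 in both systems, with the same new element [g].
    This is what makes the fractions below comparable. *)
Let gt_transport x f : exists g,
  shift (lat_of x) (orb f) = orb g /\ gammat (lat_of x) (jq f) = jq g.
Proof.
elim/zplus_ind: x => [|i x [g [sg gg]]].
  by exists f; rewrite lat_of0 dil_shift0 gt0.
exists (step alpha i g).
by rewrite addrC lat_ofD dil_shiftD gtD sg gg dil_orbit_step gt_step.
Qed.

(** An element may have many representations by [x] and [f]; [graphZD] and [graph_le] reconcile
    them. *)
Let graph (b : dil_alg alpha) (c : Ct) : Prop := exists x f,
  b = shift (- lat_of x) (orb f) /\ c = gammat (- lat_of x) (jq f).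

(** As for fractions, the shifts by -x and -y are brought to the common denominator x + y. *)
Let graph_common b c b' c' : graph b c -> graph b' c' -> exists x f f',
  [/\ b = shift (- lat_of x) (orb f), c = gammat (- lat_of x) (jq f),
      b' = shift (- lat_of x) (orb f') & c' = gammat (- lat_of x) (jq f')].
Proof.
move=> [x [f [-> ->]]] [y [g [-> ->]]].
have [f1 [sf gf]] := gt_transport y f; have [g1 [sg gg]] := gt_transport x g.
exists (x + y), f1, g1; rewrite -sf -gf -sg -gg -!dil_shiftD -!gtD lat_ofD.
by rewrite opprD subrK [- lat_of x - _]addrC subrK.
Qed.

(** Write h as its positive minus its negative part: the former is absorbed into [f] by
    [gt_transport], the latter enlarges the denominator. *)
Let graph_shift h b c : graph b c -> graph (shift h b) (gammat h c).
Proof.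
move=> [x [f [-> ->]]]; have [g [sg gg]] := gt_transport (pos_part h) f.
exists (x + neg_part h), g; rewrite -sg -gg -!dil_shiftD -!gtD.
suff -> : h - lat_of x = - lat_of (x + neg_part h) + lat_of (pos_part h) by [].
rewrite -[in LHS](pos_neg_part h) lat_ofD opprD.
by rewrite [RHS]addrC addrA addrAC.
Qed.

Let graph0 : graph 0 0.
Proof.
exists 0, 0; rewrite (star_hom0 (dil_orbit_hom alpha)) (star_hom0 jq_hom).
by rewrite (star_hom0 (dil_shift_hom alpha _)) (star_hom0 (gt_hom _)).
Qed.

Let graphZD k b c b' c' : graph b c -> graph b' c' ->
  graph (k *: b + b') (k *: c + c').
Proof.
move=> Gb /(graph_common Gb)[x [f [f' [-> -> -> ->]]]]; exists x, (k *: f + f').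
rewrite (star_homZD (dil_orbit_hom alpha)) (star_homZD (dil_shift_hom alpha _)).
by rewrite (star_homZD jq_hom) (star_homZD (gt_hom _)).
Qed.

Let graphM b c b' c' : graph b c -> graph b' c' -> graph (b ** b') (c ** c').
Proof.
move=> Gb /(graph_common Gb)[x [f [f' [-> -> -> ->]]]]; exists x, (f ** f').
rewrite (star_homM (dil_orbit_hom alpha)) (star_homM (dil_shift_hom alpha _)).
by rewrite (star_homM jq_hom) (star_homM (gt_hom _)).
Qed.

Let graphS b c : graph b c -> graph (star b) (star c).
Proof.
move=> [x [f [-> ->]]]; exists x, (star f).
rewrite (star_homS (dil_orbit_hom alpha)) (star_homS (dil_shift_hom alpha _)).
by rewrite (star_homS jq_hom) (star_homS (gt_hom _)).
Qed.

Let graph_le b c : graph b c -> `|c| <= `|b|.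
Proof.
by move=> [x [f [-> ->]]]; rewrite gt_norm norm_dil_shift norm_dil_orbit.
Qed.

Let graph_iota a : graph (dil_iota alpha a) (j (dfk_eta alpha a)).
Proof.
exists 0, (single 0 a).
by rewrite lat_of0 oppr0 dil_shift0 gt0 dil_orbit_iota /jq dfk_map_single.
Qed.

(** The domain of the graph is a *-subalgebra containing all shifts of iota(A). Its closure, taken
    in the ambient product, is one of the closed *-subalgebras whose intersection defines B. *)
Let graph_dense b (e : R[i]) : 0 < e ->
  exists b' c', graph b' c' /\ `|b - b'| < e.
Proof.
move=> e0.
pose D := [set (subval b' : bprod (fun _ : zlat n => A : starAlgType R)) |
  b' in [set b' | exists c, graph b' c]].
have D_sub : is_substar (closure D).
  apply: closure_substar.
  - by exists 0; [exists 0; exact: graph0|rewrite subval0].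
  - move=> k _ _ [b1 [c1 G1] <-] [b2 [c2 G2] <-].
    exists (k *: b1 + b2); first by exists (k *: c1 + c2); exact: graphZD.
    by rewrite subvalD subvalZ.
  - move=> _ _ [b1 [c1 G1] <-] [b2 [c2 G2] <-].
    by exists (b1 ** b2) => //; exists (c1 ** c2); exact: graphM.
  - move=> _ [b1 [c1 G1] <-].
    by exists (star b1) => //; exists (star c1); exact: graphS.
have : closure D (subval b).
  apply: (subval_in b); split=> // _ [g [a ->]]; apply: subset_closure.
  exists (shift g (dil_iota alpha a)) => //.
  by exists (gammat g (j (dfk_eta alpha a))); exact: graph_shift.
move=> /closure_approx /(_ e0)[_ [b' [c Gb'] <-] bb']; exists b', c; split=> //.
Qed.

Lemma dilation_hom : exists pi : dil_alg alpha -> Ct,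
  [/\ star_hom pi, forall b, `|pi b| <= `|b|,
      forall h b, pi (shift h b) = gammat h (pi b),
      forall x f, pi (shift (- lat_of x) (orb f)) =
        gammat (- lat_of x) (j (dfk_map alpha f)) &
      forall a, pi (dil_iota alpha a) = j (dfk_eta alpha a)].
Proof.
have [pi [pi_hom pi_le piE]] :=
  star_hom_extension graphZD graphM graphS graph_le graph_dense.
exists pi; split=> // [h b|x f|a]; last 2 first.
- by apply: piE; exists x, f.
- exact: piE (graph_iota a).
apply/subr0_eq/eqP; rewrite -normr_le0; apply/ler_addgt0Pr => e /= e0.
rewrite add0r; have e2 : 0 < e / 2 by rewrite divr_gt0.
have [b' [c' [Gb' bb']]] := graph_dense b e2.
(* Equivariance is exact at [b'], so the defect at [b] equals the defect at [b - b']. *)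
have -> : pi (shift h b) - gammat h (pi b) =
    pi (shift h (b - b')) - gammat h (pi (b - b')).
  rewrite (star_homB pi_hom) (star_homB (gt_hom h)).
  rewrite (star_homB (dil_shift_hom alpha h)) (star_homB pi_hom) (piE _ _ Gb').
  rewrite (piE _ _ (graph_shift h Gb')).
  by rewrite opprB addrA subrK.
rewrite (le_trans (ler_normB _ _))// (splitr e) lerD//.
  by rewrite (le_trans (pi_le _))// norm_dil_shift ltW.
by rewrite gt_norm (le_trans (pi_le _))// ltW.
Qed.

(** Minimality makes the elements gammat_{-x}(j d) dense, and [dfk_map_lift] supplies preimages of
    at most twice their norm. *)
Lemma dilation_hom_surjective (pi : dil_alg alpha -> Ct) :
  star_hom pi -> (forall b, `|pi b| <= `|b|) ->
  (forall x f, pi (shift (- lat_of x) (orb f)) =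
    gammat (- lat_of x) (j (dfk_map alpha f))) ->
  forall c, exists b, pi b = c.
Proof.
move=> pi_hom pi_le piE; apply: surjective_of_dense_lifts => //.
  apply: substar_majorized_complete.
  exact: (@bprod_majorized_complete R (zlat n) (fun _ => A)).
move=> c e e0; have : closure (\bigcup_(x in [set: zplus n])
    (gammat (- lat_of x) @` range j)) c by case: hCt => _ _ _ ->.
move=> /closure_approx /(_ e0)[_ [x _ [_ [d _ <-] <-]] cd].
have [f [fd f_le]] := dfk_map_lift d.
exists (shift (- lat_of x) (orb f)); rewrite piE fd; split=> //.
by rewrite norm_dil_shift norm_dil_orbit gt_norm j_norm.
Qed.

(** Some [orb f] lies near a shift of [b], hence near [J]; [quotient_norm_bound] at each coordinate
    then makes [jq f] small, uniformly in the coordinate. *)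
Lemma boundary_ideal_sub_ker (pi : dil_alg alpha -> Ct)
    (J : set (dil_alg alpha)) :
  star_hom pi -> (forall b, `|pi b| <= `|b|) ->
  (forall x f, pi (shift (- lat_of x) (orb f)) =
    gammat (- lat_of x) (j (dfk_map alpha f))) ->
  invariant_boundary_ideal J -> J `<=` [set b | pi b = 0].
Proof.
move=> pi_hom pi_le piE hJ b Jb /=; have [J_ideal Ji Jshift] := hJ.
have [_ _ _ Jl Jr] := J_ideal.
apply/eqP; rewrite -normr_le0; apply/ler_addgt0Pr => e /= e0; rewrite add0r.
pose r := e / 2; have r0 : 0 < r by rewrite divr_gt0.
pose M := `|b| + 1; have M0 : 0 < M by rewrite ltr_wpDl.
(* The tolerance [d] is at most 1, to keep |f| below [M]; at most [r], for the final estimate; and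
   at most r^4 / M^3, for [quotient_norm_bound]. *)
have [d1 [d10 d11 d1r]] := exists_min_gt0 ltr01 r0.
have rM0 : 0 < r ^+ 4 / M ^+ 3 by rewrite divr_gt0 ?exprn_gt0.
have [d [d0 dd1 drM]] := exists_min_gt0 d10 rM0.
have [b' [c' [[x [f [b'E _]]] bb']]] := graph_dense b d0.
have fM : `|f| <= M.
  rewrite -(norm_dil_orbit alpha) -(norm_dil_shift (- lat_of x)) -b'E.
  rewrite -[in leLHS](subrK b b') addrC (le_trans (ler_normD _ _))// lerD2l.
  by rewrite distrC (le_trans (ltW bb'))// (le_trans dd1).
pose b1 := shift (lat_of x) b.
have Jb1 : J b1 by exact: Jshift.
have b1f : `|orb f - b1| < d.
  have -> : orb f - b1 = shift (lat_of x) (b' - b).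
    rewrite (star_homB (dil_shift_hom alpha _)) b'E -dil_shiftD subrr.
    by rewrite dil_shift0.
  by rewrite norm_dil_shift distrC.
have q_le y : `|jq (single y (c0_at f y))| <= r.
  have s_hom := c0_single_hom (fun _ : zplus n => A : starAlgType R) y.
  (* Multiplication by the unit placed at coordinate [y] isolates the entry [f_y] and keeps [b1] in
     [J]. *)
  pose u := b1 ** orb (single y (dyn_one alpha)).
  apply: (@quotient_norm_bound _ _ _ _ (dyn_one alpha) (dyn_one_l alpha)
    (dyn_one_r alpha) (fun a => orb (single y a)) (fun a => jq (single y a)) J _ _
    _ _ _ _ u) => //.
  - split=> [k a a'|a a'|a].
    + by rewrite (star_homZD s_hom) (star_homZD (dil_orbit_hom alpha)).
    + by rewrite (star_homM s_hom) (star_homM (dil_orbit_hom alpha)).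
    + by rewrite (star_homS s_hom) (star_homS (dil_orbit_hom alpha)).
  - by move=> a; rewrite norm_dil_orbit norm_c0_single.
  - split=> [k a a'|a a'|a].
    + by rewrite (star_homZD s_hom) (star_homZD jq_hom).
    + by rewrite (star_homM s_hom) (star_homM jq_hom).
    + by rewrite (star_homS s_hom) (star_homS jq_hom).
  - move=> a /(boundary_single hJ) Qa.
    rewrite /jq -(star_hom0 j_hom); congr j.
    rewrite dfk_map_single; apply: c0P => z.
    rewrite c0_at0; have [<-|yz] := eqVneq y z; last by rewrite c0_single_other.
    by rewrite c0_single_same -quot_map0; apply/quot_mapP; rewrite subr0.
  - exact: Jr.
  - have -> : orb (single y (c0_at f y)) - u =
        (orb f - b1) ** orb (single y (dyn_one alpha)).
      rewrite smulBl -(star_homM (dil_orbit_hom alpha)); congr (orb _ - _).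
      apply: c0P => z; rewrite c0_atM; have [<-|yz] := eqVneq y z.
        by rewrite !c0_single_same dyn_one_r.
      by rewrite !c0_single_other// smul0r.
    have one_le : `|orb (single y (dyn_one alpha))| <= 1.
      rewrite norm_dil_orbit norm_c0_single.
      exact: norm_unit_le1 (dyn_one_l alpha) (dyn_one_r alpha).
    apply: (@le_lt_trans _ _ (M ^+ 3 * `|orb f - b1|)); last first.
      by rewrite mulrC -ltr_pdivlMr ?exprn_gt0// (lt_le_trans b1f).
    apply: ler_pM; rewrite ?exprn_ge0//.
      have fyM := le_trans (c0_at_le f y) fM.
      by apply: lerXn2r; rewrite ?nnegrE ?(ltW M0).
    by rewrite (le_trans (norm_smul _ _))// ler_piMr.
have f_le : `|jq f| <= r.
  rewrite /jq j_norm; apply: c0_norm_le => [|y]; first exact: ltW.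
  rewrite dfk_map_at (le_trans _ (q_le y))// /jq j_norm.
  have := c0_at_le (dfk_map alpha (single y (c0_at f y))) y.
  by rewrite dfk_map_at c0_single_same.
rewrite -(subrK (pi b') (pi b)) (le_trans (ler_normD _ _))// (splitr e) lerD//.
  rewrite -(star_homB pi_hom) (le_trans (pi_le _))// (le_trans (ltW bb'))//.
  exact: le_trans dd1 d1r.
by rewrite b'E piE gt_norm.
Qed.

End automorphic_dilation.

Unset Implicit Arguments.

Theorem proposition5p1 (R : realType) (n : nat) (A : cstarAlgType R)
    (alpha : unital_dynsys A n)
    (I : set (dil_alg alpha)) (hI : unique maximal_boundary_ideal I)
    (gamma : zplus n -> dfk_alg alpha -> dfk_alg alpha)
    (hgamma : dfk_action gamma)
    (Ct : cstarAlgType R) (gammat : zlat n -> Ct -> Ct)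
    (j : dfk_alg alpha -> Ct)
    (hCt : minimal_automorphic_extension gamma gammat j) :
  exists Phi : boundary_quot hI -> Ct,
    [/\ star_iso Phi,
        forall g u, Phi (quot_shift g u) = gammat g (Phi u) &
        forall a, Phi (quot_map (boundary_sideal hI) (dil_iota alpha a)) =
          j (dfk_eta alpha a)].
Proof.
have [pi [pi_hom pi_le pi_shift piE pi_iota]] := dilation_hom hgamma hCt.
have pi_surj := dilation_hom_surjective hCt pi_hom pi_le piE.
have pi_cont : continuous pi.
  apply: (@lip_continuous _ _ _ _ 1) => // b b'.
  by rewrite mul1r -(star_homB pi_hom) pi_le.
have ker_boundary : invariant_boundary_ideal [set b | pi b = 0].
  split; first split.
  - exact: closed_preimage_eq0.
  - exact: star_hom0 pi_hom.
  - by move=> c x y /= x0 y0; rewrite (star_homZD pi_hom) x0 y0 scaler0 addr0.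
  - by move=> a x /= x0; rewrite (star_homM pi_hom) x0 smul0r.
  - by move=> a x /= x0; rewrite (star_homM pi_hom) x0 smul0l.
  - move=> a /=; rewrite pi_iota => ja0.
    have j_norm c : `|j c| = `|c| by case: hCt => _ [].
    have e0 : dfk_eta alpha a = 0.
      by apply/eqP; rewrite -normr_eq0 -j_norm ja0 normr0.
    have : quot_map (dfk_Q_sideal alpha 0) a = 0.
      have := c0_at0 (fun x => quot_alg (dfk_Q_sideal alpha x)) 0.
      by rewrite -e0 c0_single_same.
    rewrite -quot_map0 => /quot_mapP; rewrite subr0 => Qa.
    (* Q_0 vanishes: the support of 0 is empty, so every element, in particular the unit, must be
       annihilated by [a]. *)
    have /(_ (dyn_one alpha)) : dfk_Q0 alpha 0 (alpha 0 a).
      by apply: Qa; apply/perp_supp => i; rewrite inE ffunE.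
    rewrite dyn_one_r => a0; have [_ alpha0 _] := dyn_actP alpha.
    rewrite alpha0 in a0; rewrite a0 => [|i]; last by rewrite inE ffunE.
    have s_hom := c0_single_hom (fun _ : zplus n => A : starAlgType R) 0.
    rewrite -dil_orbit_iota (star_hom0 s_hom).
    exact: star_hom0 (dil_orbit_hom alpha).
  - move=> g b /= b0; rewrite pi_shift b0.
    have gt_hom : star_hom (gammat g) by case: hCt => -[].
    exact: star_hom0 gt_hom.
(* [I] is contained in the kernel of [pi], itself an invariant boundary ideal; maximality of [I]
   turns this into equality. *)
have kerE b : I b <-> pi b = 0.
  case: (hI) => -[Iinv Imax] _.
  rewrite -[X in X b <-> _](Imax _ ker_boundary)//.
  exact: (boundary_ideal_sub_ker hgamma hCt).
(* Evaluated on chosen representatives; by [kerE] the choice does not matter. *)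
pose Phi (u : boundary_quot hI) := pi (quot_repr u).
have PhiE b : Phi (quot_map (boundary_sideal hI) b) = pi b.
  apply/subr0_eq; rewrite -(star_homB pi_hom); apply/kerE.
  exact: (quot_mapK (boundary_sideal hI)).
exists Phi; split; last by move=> a; rewrite PhiE.
  split.
    have q_hom := quot_map_star_hom (boundary_sideal hI).
    split=> [c|u v|u].
    - elim/quot_ind => b; elim/quot_ind => b'.
      by rewrite -(star_homZD q_hom) !PhiE (star_homZD pi_hom).
    - elim/quot_ind: u => b; elim/quot_ind: v => b'.
      by rewrite -(star_homM q_hom) !PhiE (star_homM pi_hom).
    - elim/quot_ind: u => b.
      by rewrite -(star_homS q_hom) !PhiE (star_homS pi_hom).
  have [s sP] := choice pi_surj.
  exists (fun c => quot_map (boundary_sideal hI) (s c)) => [|c]; last by rewrite PhiE.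
  elim/quot_ind => b; rewrite PhiE; apply/quot_mapP/kerE.
  by rewrite (star_homB pi_hom) sP subrr.
by move=> g; elim/quot_ind => b; rewrite quot_shiftE !PhiE.
Qed.
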